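(* Let $n$ take values only in an infinite set of odd square-free integers greater than $1$ such that \[ \frac{(\log n)^3}{p_n}\to 0 \quad\text{as } n\to\infty, \] where $p_n$ is the smallest prime factor of $n$, and let $r$ be real. Let $J(z)=\sum_{j=1}^{n-1}\left(\frac{j}{n}\right)z^j$ be the character polynomial of degree $n-1$. Then \[ \lim_{n\to\infty}F(J_r)=f(r). \]
   Context: For real $\alpha\ge1$ and $A\in\mathbb{C}[z]$, $\|A\|_\alpha=\left(\frac{1}{2\pi}\int_0^{2\pi}|A(e^{i\theta})|^\alpha d\theta\right)^{1/\alpha}$. The merit factor of $A$ is $F(A)=\frac{\|A\|_2^4}{\|A\|_4^4-\|A\|_2^4}$ (when the denominator is nonzero). For a polynomial $A$ of degree $n-1$ and real $r$, the rotation is $A_r(z)=z^{-\lfloor nr\rfloor}A(z)\bmod (z^n-1)$ (a polynomial of degree at most $n-1$). $\left(\frac{\cdot}{n}\right)$ denotes the Jacobi symbol. The function $f$ is defined by $f(r)=\dfrac{1}{\frac16+8\left(|r|-\frac14\right)^2}$ for $-\frac12<r\le\frac12$ and $f(r)=f(r+1)$ otherwise (i.e. $f$ is $1$-periodic). *)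

(* Defs.v *)
From Stdlib Require Import Reals ZArith.
From Coquelicot Require Import Coquelicot.
From mathcomp Require Import ssreflect ssrfun ssrbool eqtype ssrnat seq div prime.

Set Implicit Arguments.
Unset Strict Implicit.

Definition legendre (a p : nat) : Z :=
  if (p %| a)%N then 0%Z
  else if has (fun x => (x * x) %% p == a %% p) (iota 0 p) then 1%Z else (-1)%Z.

Definition jacobi (a n : nat) : Z :=
  foldr (fun p acc => Z.mul (Z.pow (legendre a p) (Z.of_nat (logn p n))) acc)
        1%Z (primes n).

Definition squarefree (n : nat) : Prop :=
  forall p : nat, prime p -> ~ (p * p %| n)%N.

Definition smallest_prime_factor (n : nat) : nat := pdiv n.

Open Scope R_scope.

Definition rsum (n : nat) (F : nat -> R) : R :=
  foldr (fun k acc => F k + acc) 0 (iota 0 n).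

(* real and imaginary parts of A(e^{i theta}) = sum_{k<n} a_k e^{i k theta} *)
Definition poly_re (n : nat) (a : nat -> R) (t : R) : R :=
  rsum n (fun k => a k * cos (INR k * t)).
Definition poly_im (n : nat) (a : nat -> R) (t : R) : R :=
  rsum n (fun k => a k * sin (INR k * t)).
Definition poly_abs (n : nat) (a : nat -> R) (t : R) : R :=
  sqrt (poly_re n a t ^ 2 + poly_im n a t ^ 2).

Definition powR (x y : R) : R := if Rle_dec x 0 then 0 else Rpower x y.

Definition Lnorm (alpha : R) (n : nat) (a : nat -> R) : R :=
  powR (/ (2 * PI) * RInt (fun t => powR (poly_abs n a t) alpha) 0 (2 * PI)) (/ alpha).

Definition merit_factor (n : nat) (a : nat -> R) : R :=
  Lnorm 2 n a ^ 4 / (Lnorm 4 n a ^ 4 - Lnorm 2 n a ^ 4).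

(* Rotation: A_r(z) = z^{-floor(n r)} A(z) mod (z^n - 1); its coefficient of
   z^k (0 <= k < n) is a_j with j = (k + floor(n r)) mod n.
   (Int_part x = up x - 1 is the floor of x.) *)
Definition rotation (n : nat) (a : nat -> R) (r : R) (k : nat) : R :=
  a (Z.to_nat (Z.modulo (Z.of_nat k + Int_part (INR n * r)) (Z.of_nat n))).

Definition char_coef (n : nat) (j : nat) : R :=
  if ((1 <= j) && (j <= n - 1))%N then IZR (jacobi j n) else 0.

Definition f0 (r : R) : R := / (/ 6 + 8 * (Rabs r - / 4) ^ 2).
(* 1-periodic extension: r + floor(1/2 - r) lies in (-1/2, 1/2] and is
   congruent to r mod 1 *)
Definition f_lim (r : R) : R := f0 (r + IZR (Int_part (/ 2 - r))).

(* Main.v *)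
Require Import Defs.
From Stdlib Require Import Reals ZArith Lra Lia.
From Coquelicot Require Import Coquelicot.
From mathcomp Require Import all_boot all_order all_algebra.
From mathcomp Require Import Rstruct complex zify.

(** The values of [J] at the [n]-th roots of unity are Gauss sums of modulus
    [sqrt n] or [0], so sampling at the [2n]-th roots of unity reduces the
    [L4] norm of [J_r] to the values at the odd [2n]-th roots, and these are
    obtained from the values at the [n]-th roots by Lagrange interpolation.  The
    fourth power of the interpolation formula is a weighted sum of the
    correlations [sum_j chi(j+x1) chi(j+x2) chi(j+x3) chi(j+x4)].  Quadruples in
    which the [x_i] coincide in pairs give the main term, which is evaluated
    exactly.  The other quadruples that are paired modulo some prime [q | n]
    carry total weight [O((log n)^2 / q)], and there are [O(log n)] primes [q]:
    this is where [(log n)^3 / p_n -> 0] enters.  For the remaining quadruples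
    the correlation factors over the primes [p | n] into sums of size
    [O(p^(3/4))].  In place of Weil's theorem this bound uses the fourth moment
    of [sum_y chi(g y)] over all polynomials [g] of degree at most 3, together
    with the invariance of the sum under [g y -> c g(a y + b)]. *)

Set Implicit Arguments.
Unset Strict Implicit.
Unset Printing Implicit Defensive.
Import GRing.Theory Num.Theory.
Local Open Scope R_scope.
Delimit Scope Z_scope with ZZ.
Delimit Scope R_scope with RR.

(** * Sampling the norms at roots of unity *)

(** The interpolation weights [v_x] decay like [3 / gap], so their absolute sum is [O(log n)], and
    quadruples unpaired modulo every prime contribute [O(n^(7/8) (log n)^4)]. Giving up a factor
    [p^(1/8)] absorbs the constant 500 in [c^4 <= 500 p^3], which would otherwise be raised to the
    number of primes; 250000 is [500^2]. A moment bounds a single sum because a cubic with two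
    distinct roots has about [q^3] images under scalings and affine substitutions, all with the same
    fourth power, while the moment over all polynomials is at most [3 q^6]. With [y = 4|r| - 1] for
    [|r| <= 1/2], the weights satisfy [sum |v|^2 = 1], [sum |v|^4 -> 1/3] and [|sum v^2|^2 -> y^2].
    In the same units the odd points give [n (y^2 + 2 - 2/3)] and the even points about [n], so
    [1/F] tends to [(1 + y^2 + 4/3)/2 - 1 = 1/6 + 8 (|r| - 1/4)^2]. *)

Lemma rsumE (n : nat) (F : nat -> R) : rsum n F = (\sum_(k < n) F k)%R.
Proof.
rewrite /rsum -(big_mkord predT) unlock /= /reducebig /index_iota subn0.
by elim: (iota 0 n) => //= k s ->.
Qed.

Section TrigonometricAverages.

Variable n : nat.
Hypothesis n0 : (0 < n)%N.

(** Joins the mean over the circle and the mean over the [2n]-th roots of unity in one predicate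
    closed under linear combinations, so exactness of the sampling has to be checked on cosines
    only. *)
Definition sampled_mean (f : R -> R) (v : R) : Prop :=
  is_RInt f 0 (2 * PI) (2 * PI * v) /\
  (\sum_(j < 2 * n) f (PI * INR j / INR n)%RR)%R = 2 * INR n * v.

Lemma sampled_mean_ext f g v : (forall t, f t = g t) -> sampled_mean f v -> sampled_mean g v.
Proof.
move=> e [h1 h2]; split; first by apply: is_RInt_ext h1 => t _.
by rewrite -h2; apply: eq_bigr => j _; rewrite e.
Qed.

Lemma sampled_mean_scal f v c : sampled_mean f v -> sampled_mean (fun t => c * f t) (c * v).
Proof.
move=> [h1 h2]; split.
  have := is_RInt_scal _ _ _ c _ h1; rewrite /scal /= /mult /=.
  by have -> : c * (2 * PI * v) = 2 * PI * (c * v) by ring.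
have -> : 2 * INR n * (c * v) = c * (2 * INR n * v) by ring.
by rewrite -h2 [RHS]RmultE mulr_sumr.
Qed.

Lemma sampled_mean_plus f g v w : sampled_mean f v -> sampled_mean g w ->
  sampled_mean (fun t => f t + g t) (v + w).
Proof.
move=> [h1 h2] [h3 h4]; split.
  have := is_RInt_plus _ _ _ _ _ _ h1 h3; rewrite /plus /=.
  by have -> : 2 * PI * v + 2 * PI * w = 2 * PI * (v + w) by ring.
have -> : 2 * INR n * (v + w) = 2 * INR n * v + 2 * INR n * w by ring.
by rewrite -h2 -h4 [RHS]RplusE -big_split.
Qed.

Lemma sampled_mean_sum (I : Type) (s : seq I) (f : I -> R -> R) (v : I -> R) :
  (forall i, sampled_mean (f i) (v i)) ->
  sampled_mean (fun t => \sum_(i <- s) f i t)%R (\sum_(i <- s) v i)%R.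
Proof.
move=> H; elim: s => [|i s IH].
  rewrite big_nil; apply: (@sampled_mean_ext (fun=> 0)) => [t|]; first by rewrite big_nil.
  split; last by rewrite big1 // Rmult_0_r.
  rewrite Rmult_0_r; have := is_RInt_const 0 (2 * PI) 0.
  by rewrite /scal /= /mult /= Rmult_0_r.
rewrite big_cons; apply: (@sampled_mean_ext (fun t => f i t + (\sum_(i <- s) f i t)%R)).
  by move=> t; rewrite big_cons.
exact: sampled_mean_plus.
Qed.

(** Telescoping: [2 sin h cos (2 h j) = sin ((2j+1) h) - sin ((2j-1) h)]. *)
Lemma sum_cos (N : nat) (h : R) :
  2 * sin h * (\sum_(j < N) cos (2 * h * INR j)%RR)%R = sin ((2 * INR N - 1) * h) + sin h.
Proof.
elim: N => [|N IH].
  rewrite big_ord0 Rmult_0_r /=.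
  have -> : (2 * 0 - 1) * h = - h by ring.
  by rewrite sin_neg; ring.
rewrite big_ord_recr /= -RplusE Rmult_plus_distr_l IH -/(INR N.+1) S_INR.
have -> : (2 * (INR N + 1) - 1) * h = 2 * h * INR N + h by ring.
have -> : (2 * INR N - 1) * h = 2 * h * INR N - h by ring.
by rewrite sin_plus sin_minus; ring.
Qed.

Lemma INR2n : INR (2 * n) = 2 * INR n.
Proof. exact: mult_INR. Qed.

(** A nonzero frequency smaller than [2n] in modulus is not a multiple of [2n], so sampling does not
    confuse it with the constant. *)
Lemma sampled_mean_cos (m : Z) : (Z.abs m < 2 * Z.of_nat n)%ZZ ->
  sampled_mean (fun t => cos (IZR m * t)) (if Z.eqb m 0 then 1 else 0).
Proof.
move=> mn; have INn : 0 < INR n by apply: lt_0_INR; apply/ltP.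
case: Z.eqb_spec => [->|m0].
  apply: (@sampled_mean_ext (fun=> 1)) => [t|]; first by rewrite Rmult_0_l cos_0.
  split; last by rewrite sumr_const card_ord -INRE INR2n Rmult_1_r.
  have := is_RInt_const 0 (2 * PI) 1; rewrite /scal /= /mult /=.
  by have -> : (2 * PI - 0) * 1 = 2 * PI * 1 by ring.
have m0' : IZR m <> 0 by move/eq_IZR.
split.
  have -> : 2 * PI * 0 = minus (sin (IZR m * (2 * PI)) / IZR m) (sin (IZR m * 0) / IZR m).
    have -> : IZR m * (2 * PI) = 2 * IZR m * PI by ring.
    rewrite /minus /plus /opp /= !Rmult_0_r sin_0.
    have -> : 2 * IZR m * PI = IZR (2 * m) * PI by rewrite mult_IZR.
    have -> : sin (IZR (2 * m) * PI) = 0 by apply: sin_eq_0_1; exists (2 * m)%ZZ.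
    by rewrite /Hierarchy.opp /=; field.
  apply: (@is_RInt_derive _ (fun t => sin (IZR m * t) / IZR m)).
    by move=> t _; auto_derive => //; field.
  move=> t _; apply: (@ex_derive_continuous _ _ _); by auto_derive.
rewrite Rmult_0_r.
(* Half the phase step; [0 < |m| < 2n] gives [0 < |h| < PI], whence [sin h <> 0]. *)
pose h := IZR m * PI / (2 * INR n).
have sh : sin h <> 0.
  have mn' : IZR (Z.abs m) < 2 * INR n.
    by rewrite INR_IZR_INZ -mult_IZR; apply: IZR_lt.
  have PI0 := PI_RGT_0.
  have pos k : 0 < k -> k < 2 * INR n -> 0 < sin (k * PI / (2 * INR n)).
    move=> k0 kn; apply: sin_gt_0.
      by apply: Rdiv_lt_0_compat; [apply: Rmult_lt_0_compat|lra].
    apply: (Rmult_lt_reg_r (2 * INR n)); first lra.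
    have -> : k * PI / (2 * INR n) * (2 * INR n) = k * PI by field; lra.
    nra.
  case: (Z.lt_trichotomy m 0) => [neg|[//|po]].
    have := pos (- IZR m); rewrite /h.
    have -> : - IZR m * PI / (2 * INR n) = - (IZR m * PI / (2 * INR n)) by field; lra.
    rewrite sin_neg; have := IZR_lt _ _ neg => neg'.
    rewrite Z.abs_neq in mn'; last lia.
    rewrite opp_IZR in mn' => /(_ ltac:(lra) ltac:(lra)); lra.
  have := pos (IZR m); have := IZR_lt _ _ po => po'.
  rewrite Z.abs_eq in mn'; last lia.
  move=> /(_ ltac:(lra) ltac:(lra)); rewrite -/h; lra.
have E : (\sum_(j < 2 * n) cos (IZR m * (PI * INR j / INR n))%RR)%R
   = (\sum_(j < 2 * n) cos (2 * h * INR j)%RR)%R.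
  by apply: eq_bigr => j _; congr cos; rewrite /h; field; lra.
have := sum_cos (2 * n) h; rewrite -E => H.
have H0 : sin ((2 * INR (2 * n) - 1) * h) + sin h = 0.
  rewrite INR2n.
  have -> : (2 * (2 * INR n) - 1) * h = - h + 2 * IZR m * PI.
    by rewrite /h; field; lra.
  have -> : sin (- h + 2 * IZR m * PI) = sin (- h).
    rewrite sin_plus.
    have -> : 2 * IZR m * PI = 2 * (IZR m * PI) by ring.
    have s0 : sin (IZR m * PI) = 0 by apply: sin_eq_0_1; exists m.
    rewrite cos_2a_sin sin_2a s0; ring.
  rewrite sin_neg; ring.
rewrite H0 in H; case: (Rmult_integral _ _ H) => // h2.
by case: sh; lra.
Qed.

Variable a : nat -> R.

Definition power (t : R) : R := poly_re n a t ^ 2 + poly_im n a t ^ 2.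

Let d (k l : nat) : Z := (Z.of_nat k - Z.of_nat l)%ZZ.

Lemma powerE t : power t =
  (\sum_(k < n) \sum_(l < n) (a k * a l * cos (IZR (d k l) * t))%RR)%R.
Proof.
rewrite /power /poly_re /poly_im !rsumE !RpowE !expr2 !big_distrlr /=.
rewrite RplusE -big_split; apply: eq_bigr => k _.
rewrite -big_split; apply: eq_bigr => l _ /=.
rewrite -!RplusE -!RmultE /d minus_IZR -!INR_IZR_INZ Rmult_minus_distr_r cos_minus; ring.
Qed.

Lemma sampled_mean_power : sampled_mean power (rsum n (fun k => a k ^ 2)).
Proof.
have -> : rsum n (fun k => a k ^ 2)
   = (\sum_(k < n) \sum_(l < n) (a k * a l * (if Z.eqb (d k l) 0 then 1 else 0))%RR)%R.
  rewrite rsumE; apply: eq_bigr => k _; rewrite (bigD1 k) //= big1 ?addr0.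
    by rewrite /d Z.sub_diag /=; ring.
  move=> l lk.
  have -> : (d k l =? 0)%ZZ = false.
    apply/Z.eqb_spec => e; move/eqP: lk; apply; apply: val_inj => /=.
    by rewrite /d in e; lia.
  exact: Rmult_0_r.
apply: (@sampled_mean_ext (fun t => \sum_(k < n) \sum_(l < n) (a k * a l * cos (IZR (d k l) * t))%RR)%R).
  by move=> t; rewrite powerE.
apply: sampled_mean_sum => k; apply: sampled_mean_sum => l.
apply: sampled_mean_scal; apply: sampled_mean_cos.
have /ltP := ltn_ord k; have /ltP := ltn_ord l; rewrite /d; lia.
Qed.

(** The frequencies are sums and differences of two integers of modulus at most [n - 1], hence below
    [2n]: this is why [2n] points are used. *)
Lemma sampled_mean_power2 : exists v, sampled_mean (fun t => power t ^ 2) v.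
Proof.
pose c k l k' l' : R := (a k * a l * (a k' * a l')) / 2.
exists (\sum_(k < n) \sum_(l < n) \sum_(k' < n) \sum_(l' < n)
  (c k l k' l' * ((if Z.eqb (d k l - d k' l') 0 then 1 else 0)
   + (if Z.eqb (d k l + d k' l') 0 then 1 else 0)))%RR)%R.
apply: (@sampled_mean_ext (fun t => \sum_(k < n) \sum_(l < n) \sum_(k' < n) \sum_(l' < n)
  (c k l k' l' * (cos (IZR (d k l - d k' l') * t) + cos (IZR (d k l + d k' l') * t)))%RR)%R).
  move=> t; rewrite powerE RpowE expr2 [RHS]mulr_suml; apply: eq_bigr => k _.
  rewrite [RHS]mulr_suml; apply: eq_bigr => l _.
  rewrite [RHS]mulr_sumr; apply: eq_bigr => k' _.
  rewrite [RHS]mulr_sumr; apply: eq_bigr => l' _.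
  rewrite -RmultE /c minus_IZR plus_IZR Rmult_minus_distr_r Rmult_plus_distr_r.
  rewrite cos_minus cos_plus; field.
apply: sampled_mean_sum => k; apply: sampled_mean_sum => l.
apply: sampled_mean_sum => k'; apply: sampled_mean_sum => l'.
apply: sampled_mean_scal.
move: (ltn_ord k) (ltn_ord l) (ltn_ord k') (ltn_ord l') => /ltP ? /ltP ? /ltP ? /ltP ?.
by apply: sampled_mean_plus; apply: sampled_mean_cos; rewrite /d; lia.
Qed.

End TrigonometricAverages.

Lemma power_ge0 n a t : 0 <= power n a t.
Proof. by apply: Rplus_le_le_0_compat; apply: pow2_ge_0. Qed.

(** The condition [0 < k] matters at [x = 0]: [powR 0 0] is 0 while [0 ^ 0] is 1. *)
Lemma powR_nat (x : R) (k : nat) : 0 <= x -> (0 < k)%N -> powR x (INR k) = x ^ k.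
Proof.
move=> x0 k0; rewrite /powR; case: Rle_dec => /= [le|nle].
  have -> : x = 0 by apply: Rle_antisym.
  by rewrite pow_i //; apply/ltP.
by rewrite Rpower_pow //; lra.
Qed.

Lemma powR_root (x y : R) (k l : nat) : 0 <= x -> (0 < k)%N -> (0 < l)%N ->
  y * INR k = INR l -> powR x y ^ k = x ^ l.
Proof.
move=> x0 k0 l0 e; rewrite /powR; case: Rle_dec => /= [le|nle].
  have -> : x = 0 by apply: Rle_antisym.
  by rewrite !pow_i //; apply/ltP.
rewrite -Rpower_pow; last exact: exp_pos.
by rewrite Rpower_mult e Rpower_pow //; lra.
Qed.

Lemma poly_abs_pow (n : nat) (a : nat -> R) t : poly_abs n a t ^ 2 = power n a t.
Proof. by rewrite /poly_abs -/(power n a t) pow2_sqrt //; exact: power_ge0. Qed.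

Lemma Lnorm2_pow4 (n : nat) (a : nat -> R) : (0 < n)%N ->
  Lnorm 2 n a ^ 4 = rsum n (fun k => a k ^ 2) ^ 2.
Proof.
move=> n0; rewrite /Lnorm.
have -> : RInt (fun t => powR (poly_abs n a t) 2) 0 (2 * PI) = 2 * PI * rsum n (fun k => a k ^ 2).
  have [H _] := sampled_mean_power n0 a.
  apply: is_RInt_unique; apply: is_RInt_ext H => t _.
  by rewrite -poly_abs_pow -powR_nat //; apply: sqrt_pos.
have -> : / (2 * PI) * (2 * PI * rsum n (fun k => a k ^ 2)) = rsum n (fun k => a k ^ 2).
  by field; have := PI_RGT_0; lra.
apply: powR_root => //; last by rewrite /=; field.
rewrite rsumE; elim/big_ind: _ => [|x y|k _]; [exact: Rle_refl|exact: Rplus_le_le_0_compat|exact: pow2_ge_0].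
Qed.

Lemma Lnorm4_pow4 (n : nat) (a : nat -> R) : (0 < n)%N ->
  Lnorm 4 n a ^ 4 = (\sum_(j < 2 * n) (power n a (PI * INR j / INR n) ^ 2)%RR)%R / (2 * INR n).
Proof.
move=> n0; rewrite /Lnorm; have [v [H1 H2]] := sampled_mean_power2 n0 a.
have n0' : 0 < INR n by apply: lt_0_INR; apply/ltP.
rewrite H2.
have -> : RInt (fun t => powR (poly_abs n a t) 4) 0 (2 * PI) = 2 * PI * v.
  apply: is_RInt_unique; apply: is_RInt_ext H1 => t _.
  rewrite -poly_abs_pow.
  have -> : 4 = INR 4 by rewrite /=; ring.
  by rewrite powR_nat -?pow_mult //; exact: sqrt_pos.
have -> : / (2 * PI) * (2 * PI * v) = v.
  by field; have := PI_RGT_0; lra.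
have -> : 2 * INR n * v / (2 * INR n) = v by field; lra.
rewrite (@powR_root v (/ 4) 4 1) //; [by rewrite pow_1| |by rewrite /=; field].
have : 0 <= 2 * INR n * v.
  rewrite -H2; elim/big_ind: _ => [|x y|k _]; [exact: Rle_refl|exact: Rplus_le_le_0_compat|exact: pow2_ge_0].
move=> h; apply: (Rmult_le_reg_l (2 * INR n)); lra.
Qed.

(** Up to [PI / 3] the mean value theorem gives slope at least 1/2; beyond it,
    [sin t >= 1/2 >= PI / 8 >= t / 4]. *)
Lemma sin_ge_quarter t : 0 <= t -> t <= PI / 2 -> t / 4 <= sin t.
Proof.
move=> t0 t1; have PI0 := PI_RGT_0.
have [le|gt] := Rle_dec t (PI / 3).
  case: (Req_dec t 0) => [->|nt]; first by rewrite sin_0; lra.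
  have [c [e [c0 ct]]] : exists c, sin t - sin 0 = cos c * (t - 0) /\ 0 < c < t.
    apply: (MVT_cor2 sin cos); first lra.
    by move=> c _; apply: derivable_pt_lim_sin.
  have : cos (PI / 3) <= cos c by apply: cos_decr_1; lra.
  rewrite cos_PI3 => hc; rewrite sin_0 in e.
  have : (1 / 2) * t <= cos c * t by apply: Rmult_le_compat_r; lra.
  lra.
have : sin (PI / 3) <= sin t by apply: sin_incr_1; lra.
rewrite sin_PI3.
have s3 : 1 <= sqrt 3 by rewrite -sqrt_1; apply: sqrt_le_1_alt; lra.
have := PI_4; lra.
Qed.

(** Will bound [|zeta^(2x+1) - 1|] below by the distance from [2x+1] to the multiples of [2n]. The
    constant 3 suffices because [3 PI / 8 > 1]; the far half of the range is reflected by
    [sin (PI - t) = sin t]. *)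
Lemma minn_sin_le (n x : nat) : (x < n)%N ->
  INR (minn (2 * x + 1) (2 * n - (2 * x + 1)))
    <= 3 * INR n * sin (PI * INR (2 * x + 1) / (2 * INR n)).
Proof.
move=> xn; have n0 : 0 < INR n by apply: lt_0_INR; move/ltP: xn; lia.
have PI3 : 3 < PI by have := PI2_3_2; lra.
have base (k : nat) : (k <= n)%N -> INR k <= 3 * INR n * sin (PI * INR k / (2 * INR n)).
  move=> /leP /le_INR kn; have k0 := pos_INR k.
  have e : PI * INR k / (2 * INR n) = PI / 2 * (INR k / INR n) by field; lra.
  have q0 : 0 <= INR k / INR n by apply: Rdiv_le_0_compat.
  have q1 : INR k / INR n <= 1.
    by apply: (Rmult_le_reg_r (INR n)) => //; rewrite /Rdiv Rmult_assoc Rinv_l; lra.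
  have := @sin_ge_quarter (PI * INR k / (2 * INR n)).
  rewrite e => /(_ ltac:(nra) ltac:(nra)) h.
  have : INR n * (PI / 2 * (INR k / INR n) / 4) <= INR n * sin (PI / 2 * (INR k / INR n)).
    by apply: Rmult_le_compat_l; lra.
  have -> : INR n * (PI / 2 * (INR k / INR n) / 4) = PI * INR k / 8 by field; lra.
  nra.
rewrite /minn; case: ltnP => h.
  by apply: base; lia.
have -> : PI * INR (2 * x + 1) / (2 * INR n)
    = PI - PI * INR (2 * n - (2 * x + 1)) / (2 * INR n).
  have -> : INR (2 * n - (2 * x + 1)) = 2 * INR n - INR (2 * x + 1).
    rewrite minus_INR; last by lia.
    by rewrite -[(2 * n)%N]/(Nat.mul 2 n) (mult_INR 2).
  by field; lra.
rewrite sin_PI_x; apply: base; lia.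
Qed.

(** Each step is [1/(n+1) <= ln ((n+1)/n)], a form of [1 - u <= exp (-u)]. *)
Lemma harmonic_le_ln (n : nat) : (0 < n)%N ->
  (\sum_(i < n) (INR i.+1)^-1)%R <= 1 + ln (INR n).
Proof.
case: n => // n _; elim: n => [|n IH].
  by rewrite big_ord1 /= ln_1 -RinvE Rinv_1; lra.
have -> : (\sum_(i < n.+2) (INR i.+1)^-1)%R
    = (\sum_(i < n.+1) (INR i.+1)^-1)%R + / INR n.+2 by rewrite big_ord_recr.
have p1 : 0 < INR n.+1 by apply: lt_0_INR; lia.
have p2 : 0 < INR n.+2 by apply: lt_0_INR; lia.
have e : INR n.+2 = INR n.+1 + 1 by rewrite S_INR.
suff : / INR n.+2 <= ln (INR n.+2) - ln (INR n.+1) by lra.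
rewrite -ln_div //.
have : ln (INR n.+1 / INR n.+2) <= - / INR n.+2.
  rewrite -[X in _ <= X]ln_exp; apply: ln_le; first exact: Rdiv_lt_0_compat.
  have := exp_ineq1_le (- / INR n.+2).
  have -> : INR n.+1 / INR n.+2 = 1 + - / INR n.+2 by rewrite e; field; lra.
  by [].
rewrite !ln_div //; lra.
Qed.

(** * The primitive [2n]-th root of unity in [R[i]] *)

Definition zeta (n : nat) : R[i] := Complex (cos (PI / INR n)) (sin (PI / INR n)).

Lemma zetaX (n k : nat) : (zeta n ^+ k)%R =
  Complex (cos (INR k * (PI / INR n))) (sin (INR k * (PI / INR n))).
Proof.
elim: k => [|k IH]; first by rewrite expr0 /= Rmult_0_l cos_0 sin_0.
rewrite exprS IH /zeta S_INR Rmult_plus_distr_r Rmult_1_l Rplus_comm.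
rewrite cos_plus sin_plus /GRing.mul /=; congr Complex.
by rewrite Rplus_comm -RplusE -!RmultE; ring.
Qed.

Section Zeta.

Variable n : nat.
Hypothesis n0 : (0 < n)%N.

Let In0 : 0 < INR n. Proof. by apply: lt_0_INR; apply/ltP. Qed.

Lemma zeta_n : (zeta n ^+ n = -1)%R.
Proof.
rewrite zetaX; have -> : INR n * (PI / INR n) = PI by field; lra.
rewrite cos_PI sin_PI; apply/eqP; rewrite eq_complex /=; apply/andP; split; apply/eqP => //.
by rewrite -RoppE; exact: esym Ropp_0.
Qed.

Lemma zeta_prim : (n.-primitive_root (zeta n ^+ 2))%R.
Proof.
rewrite /primitive_root_of_unity n0; apply/forallP => i; apply/eqP.
rewrite unity_rootE -exprM; have := ltn_ord i; rewrite leq_eqVlt => /orP[/eqP e|lt].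
  by rewrite e eqxx mulnC exprM zeta_n expr2 mulN1r opprK eqxx.
rewrite (ltn_eqF lt); apply/negbTE/eqP => /(congr1 (@complex.Re R)).
rewrite zetaX /=.
have -> : INR (2 * i.+1) * (PI / INR n) = 2 * (INR i.+1 * (PI / INR n)).
  by rewrite -[(2 * i.+1)%N]/(Nat.mul 2 i.+1) mult_INR /=; ring.
have sp : 0 < sin (INR i.+1 * (PI / INR n)).
  have i0 : 0 < INR i.+1 by apply: lt_0_INR; lia.
  have /ltP/lt_INR il := lt; have PI0 := PI_RGT_0.
  have P0 : 0 < PI / INR n by apply: Rdiv_lt_0_compat.
  apply: sin_gt_0; first exact: Rmult_lt_0_compat.
  have -> : PI = INR n * (PI / INR n) by field; lra.
  have -> : INR n * (PI / INR n) / INR n = PI / INR n by field; lra.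
  by apply: Rmult_lt_compat_r.
rewrite cos_2a_sin => h.
have h' : 1 - 2 * sin (INR i.+1 * (PI / INR n)) * sin (INR i.+1 * (PI / INR n)) = 1 by exact: h.
nra.
Qed.

Lemma norm_zeta_sub1 (x : nat) : (x < n)%N ->
  (`|zeta n ^+ (2 * x + 1) - 1| =
    ((2 * sin (PI * INR (2 * x + 1) / (2 * INR n)))%RR)%:C)%R%C.
Proof.
move=> xn.
have s0 : 0 <= sin (PI * INR (2 * x + 1) / (2 * INR n)).
  have := minn_sin_le xn; have := pos_INR (minn (2 * x + 1) (2 * n - (2 * x + 1))).
  by nra.
apply/eqP; rewrite -(@eqrXn2 _ 2) ?normr_ge0 //; last first.
  by rewrite ler0c; apply/RleP; exact: (Rmult_le_pos 2 _ ltac:(lra) s0).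
rewrite -add_Re2_Im2 -rmorphXn /=; apply/eqP; congr (_%:C)%C.
rewrite zetaX /= -!RpowE -RplusE.
have -> : INR (2 * x + 1) * (PI / INR n) = 2 * (PI * INR (2 * x + 1) / (2 * INR n)) by field; lra.
set t := _ / _.
change ((cos (2 * t) - 1) ^ 2 + (sin (2 * t) - 0) ^ 2 = (2 * sin t) ^ 2).
rewrite cos_2a_sin sin_2a; have := sin2_cos2 t; rewrite /Rsqr => h.
have -> : (1 - 2 * sin t * sin t - 1) ^ 2 + (2 * sin t * cos t - 0) ^ 2
  = 4 * (sin t * sin t) * (sin t * sin t + cos t * cos t) by ring.
by rewrite h; ring.
Qed.

Lemma power_zeta (a : nat -> R) (t : nat) :
  (`|\sum_(k < n) (a k)%:C * zeta n ^+ (k * t)| ^+ 2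
     = (power n a (PI * INR t / INR n)%RR)%:C)%R%C.
Proof.
rewrite -add_Re2_Im2; congr (_%:C)%C.
have ReD : {morph @complex.Re R : x y / (x + y)%R} by case=> [x1 x2] [y1 y2].
have ImD : {morph @complex.Im R : x y / (x + y)%R} by case=> [x1 x2] [y1 y2].
rewrite (big_morph _ ReD (erefl : complex.Re 0%R = 0%R)) (big_morph _ ImD (erefl : complex.Im 0%R = 0%R)).
rewrite /power /poly_re /poly_im !rsumE -!RpowE.
have e (k : nat) : INR k * (PI * INR t / INR n) = INR (k * t) * (PI / INR n).
  by rewrite -[(k * t)%N]/(Nat.mul k t) mult_INR; field; lra.
congr (_ ^ 2 + _ ^ 2)%RR; apply: eq_bigr => k _; rewrite zetaX e /=.
  by rewrite mul0r subr0.
by rewrite mul0r addr0.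
Qed.

End Zeta.

(** * Real estimates for the limit *)

Definition shift (n : nat) (r : R) : nat :=
  Z.to_nat (Z.modulo (Int_part (INR n * r)) (Z.of_nat n)).

Definition reduced (r : R) : R := r + IZR (Int_part (/ 2 - r)).

Lemma Int_part_bounds x : IZR (Int_part x) <= x < IZR (Int_part x) + 1.
Proof. by have := base_Int_part x; lra. Qed.

Lemma reduced_bounds r : - / 2 < reduced r <= / 2.
Proof. by rewrite /reduced; have := Int_part_bounds (/ 2 - r); lra. Qed.

(** Here [v] is the residue of [-2 floor (n r)], and [v / n = c - 2 r' + O(1/n)] with [c] in
    [{-1, 0, 1}], so the first base is close to [2c - 1 - 4r']. For [c = 1] with [r' >= 0], and for
    [c = 0] with [r' < 0], this is [4|r'| - 1] up to sign. The other cases force [r'] within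
    [O(1/n)] of 0 or of -1/2, where both squares are near 1. *)
Lemma phase_limit (n v : nat) (r : R) : (3 <= n)%N -> (v < n)%N ->
  (n %| v + 2 * shift n r)%N ->
  Rabs (((2 * INR v + 2 - INR n) / INR n) ^ 2 - (4 * Rabs (reduced r) - 1) ^ 2)
    <= 100 / INR n.
Proof.
move=> n3 vn dv; have [lo hi] := reduced_bounds r.
set r' := reduced r in lo hi *.
have N3 : 3 <= INR n by have := le_INR 3 n; rewrite /=; lra || (move/(_ ltac:(lia)); lra).
set k := Int_part (/ 2 - r); set fl := Int_part (INR n * r).
have [f1 f2] := Int_part_bounds (INR n * r); rewrite -/fl in f1 f2.
have nz : Z.of_nat n <> Z0 by lia.
have sfl : Z.of_nat (shift n r) = Z.modulo fl (Z.of_nat n).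
  by rewrite /shift -/fl Z2Nat.id //; have := Z.mod_pos_bound fl (Z.of_nat n); lia.
have [b eb] : exists b : Z, (Z.of_nat v + 2 * Z.of_nat (shift n r) = b * Z.of_nat n)%ZZ.
  by case/dvdnP: dv => b e; exists (Z.of_nat b); lia.
pose g := (fl + Z.of_nat n * k)%ZZ.
pose c := (b + 2 * (fl / Z.of_nat n) + 2 * k)%ZZ.
have ev : Z.of_nat v = (c * Z.of_nat n - 2 * g)%ZZ.
  have := Z.div_mod fl (Z.of_nat n) nz; rewrite -sfl /c /g; nia.
have gE : IZR g = IZR fl + INR n * IZR k by rewrite /g plus_IZR mult_IZR -INR_IZR_INZ.
have evR : INR v = IZR c * INR n - 2 * IZR g.
  by rewrite !INR_IZR_INZ ev minus_IZR !mult_IZR.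
have nr : INR n * r = INR n * r' - INR n * IZR k.
  by rewrite /r' /reduced -/k; ring.
(* The fractional part of [n r]: [g] is the floor of [n r']. *)
pose th := INR n * r' - IZR g.
have th0 : 0 <= th < 1 by rewrite /th gE; lra.
have ni0 : 0 < / INR n by apply: Rinv_0_lt_compat; lra.
have ni1 : / INR n <= / 3 by apply: Rinv_le_contravar; lra.
set i := / INR n in ni0 ni1.
have iE : i * INR n = 1 by rewrite /i; field; lra.
have vi : INR v * i = IZR c - 2 * r' + 2 * th * i.
  rewrite evR /th.
  have -> : IZR g = INR n * r' - th by rewrite /th; ring.
  have -> : (IZR c * INR n - 2 * (INR n * r' - th)) * i = (i * INR n) * (IZR c - 2 * r') + 2 * th * i by ring.
  by rewrite iE /th gE; ring.
have v0 : 0 <= INR v * i by apply: Rmult_le_pos; [exact: pos_INR|lra].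
have v1 : INR v * i < 1.
  rewrite -iE Rmult_comm; apply: Rmult_lt_compat_l => //.
  by apply: lt_INR; lia.
have thi : 0 <= th * i < i by split; [apply: Rmult_le_pos; lra|nra].
pose e := (4 * th + 2) * i.
have e0 : 0 < e <= 6 * i by rewrite /e; nra.
have -> : (2 * INR v + 2 - INR n) / INR n = 2 * IZR c - 1 - 4 * r' + e.
  have -> : (2 * INR v + 2 - INR n) / INR n = 2 * (INR v * i) + 2 * i - i * INR n.
    by rewrite /i; field; lra.
  by rewrite vi iE /e; ring.
rewrite /Rdiv -/i.
have c1 : (c < 2)%ZZ by apply: lt_IZR; nra.
have c2 : (-2 < c)%ZZ by apply: lt_IZR; nra.
have [cE|[cE|cE]] : c = (-1)%ZZ \/ c = 0%ZZ \/ c = 1%ZZ by lia.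
- have rn : r' < 0 by rewrite cE in vi; nra.
  rewrite (Rabs_left r') //; apply: Rabs_le; rewrite cE in vi *; split; nra.
- case: (Rle_dec 0 r') => [rp|rn].
    rewrite (Rabs_pos_eq r') //; apply: Rabs_le; rewrite cE in vi *; split; nra.
  rewrite (Rabs_left r'); last lra.
  apply: Rabs_le; rewrite cE in vi *; split; nra.
- have rp : 0 <= r' by rewrite cE in vi; nra.
  rewrite (Rabs_pos_eq r') //; apply: Rabs_le; rewrite cE in vi *; split; nra.
Qed.

Lemma f_limE r : f_lim r = / (/ 6 + (4 * Rabs (reduced r) - 1) ^ 2 / 2).
Proof. by rewrite /f_lim /f0 -/(reduced r); congr Rinv; field. Qed.

(** With [eta = 1 - Phi/N] and [psi = Q/N], [X] is the reciprocal of the merit factor, and it equals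
    [Y] when [eta = 0] and [psi = 1 + 2Y]. The smallness condition keeps [X >= 1/12]; then
    [144 = 2 * 12 * 6]. *)
Lemma ratio_close (eta psi Y delta : R) :
  0 <= eta <= / 2 -> / 6 <= Y <= 2 / 3 -> Rabs (psi - (1 + 2 * Y)) <= delta ->
  2 * (delta + 8 * eta) <= / 12 ->
  let X := (1 - eta + psi) / (2 * (1 - eta) ^ 2) - 1 in
  0 < X /\ Rabs (/ X - / Y) <= 144 * (delta + 8 * eta).
Proof.
move=> [e0 e1] [Y0 Y1] /Rabs_le_between [d1 d2] small X.
set q := (1 - eta) ^ 2.
have q0 : / 4 <= q by rewrite /q; nra.
have XY : Rabs (X - Y) <= 2 * (delta + 8 * eta).
  have E : (X - Y) * (2 * q) = (1 - eta + psi) - 2 * q * (1 + Y).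
    by rewrite /X -/q; field; lra.
  have num : Rabs ((X - Y) * (2 * q)) <= delta + 8 * eta.
    rewrite E /q; apply: Rabs_le; split; nra.
  rewrite Rabs_mult (Rabs_pos_eq (2 * q)) in num; last lra.
  have := Rabs_pos (X - Y); nra.
move/Rabs_le_between: (XY) => [y1 y2].
have X0 : / 12 <= X by lra.
split; first lra.
have -> : / X - / Y = (Y - X) * (/ X * / Y) by field; lra.
rewrite Rabs_mult Rabs_minus_sym.
have iX : 0 < / X <= 12.
  by split; [apply: Rinv_0_lt_compat; lra|rewrite -[12]Rinv_inv; apply: Rinv_le_contravar; lra].
have iY : 0 < / Y <= 6.
  by split; [apply: Rinv_0_lt_compat; lra|rewrite -[6]Rinv_inv; apply: Rinv_le_contravar; lra].
rewrite (Rabs_pos_eq (/ X * / Y)); last by nra.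
have := Rabs_pos (X - Y).
have : / X * / Y <= 72 by nra.
have : 0 < / X * / Y by nra.
nra.
Qed.

(** Raises [u <= exp u] at [u = L/40] to the fifth power, one more than needed, which leaves the
    decay [1/L]. *)
Lemma ln_pow4_exp (L : R) : 1 <= L -> L ^ 4 * exp (- (L / 8)) <= 40 ^ 5 / L.
Proof.
move=> L1.
have h : (L / 40) ^ 5 <= exp (L / 8).
  have -> : L / 8 = L / 40 + L / 40 + L / 40 + L / 40 + L / 40 by field.
  rewrite !exp_plus.
  have x0 : 0 <= L / 40 by lra.
  have x1 : L / 40 <= exp (L / 40) by have := exp_ineq1_le (L / 40); lra.
  have -> : exp (L / 40) * exp (L / 40) * exp (L / 40) * exp (L / 40) * exp (L / 40) = exp (L / 40) ^ 5 by ring.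
  by apply: pow_incr.
rewrite exp_Ropp.
have p0 : 0 < (L / 40) ^ 5 by apply: pow_lt; lra.
have : / exp (L / 8) <= / (L / 40) ^ 5 by apply: Rinv_le_contravar.
move=> h2; have p4 : 0 <= L ^ 4 by apply: pow_le; lra.
apply: Rle_trans (Rmult_le_compat_l _ _ _ p4 h2) _.
by apply: Req_le; field; lra.
Qed.

(** The base is [n^(7/8)], the bound for nondegenerate correlations, written so that its quotient by
    [n] is an exponential in [ln n]. *)
Lemma exp_ln_pow8 (n : nat) : (0 < n)%N ->
  (INR n * exp (- (ln (INR n) / 8))) ^ 8 = INR n ^ 7.
Proof.
move=> n0; have N0 : 0 < INR n by apply: lt_0_INR; lia.
rewrite Rpow_mult_distr -(Rpower_pow 8 (exp _)); last exact: exp_pos.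
rewrite /Rpower ln_exp.
have -> : INR 8 * - (ln (INR n) / 8) = - ln (INR n) by rewrite /=; field.
rewrite exp_Ropp exp_ln //; field; lra.
Qed.

Lemma ln_unbounded (B : R) : exists N : nat, forall n : nat, (N <= n)%N -> B <= ln (INR n).
Proof.
exists (Z.to_nat (up (exp B))) => n h; have := archimed (exp B) => -[a _].
have e0 := exp_pos B.
have : exp B <= INR n.
  have : IZR (up (exp B)) <= INR n.
    rewrite INR_IZR_INZ; apply: IZR_le; lia.
  lra.
by move=> le; rewrite -[B]ln_exp; apply: ln_le.
Qed.

(** [20736 = 12^4] comes from [(6H)^4] with [H <= 2L]; 200 covers the errors [100/N] and
    [4/(3N^2)]. *)
Definition tail_const : R := 20736 * 40 ^ 5 + 200.

(** The intended values: [Phi] counts the units modulo [n], [Q] is [dual_energy], [om] the number of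
    prime factors, [P] the least one, [phi] the base in [phase_limit], and [y = 4|r'| - 1]. After
    division by [N] the errors are [12 kap] from [6 eta], [6912 kap] from the primes and [16 kap]
    from the [8 eta] of [ratio_close], together below [7016 kap]. *)
Lemma merit_estimate (N L P om Phi Q H phi y : R) :
  3 <= N -> 1 <= L -> L <= N -> 0 < P -> 0 <= om <= 2 * L ->
  0 <= N - Phi -> (N - Phi) * P <= N * om -> 0 <= H <= 1 + L ->
  Rabs (Q - N * (phi ^ 2 + 4 / 3 - 4 / (3 * N ^ 2)))
    <= 6 * (N - Phi) + N * (om * (6 * (72 * H ^ 2 / P) * (72 * H ^ 2 / P + 1)))
       + N * exp (- (L / 8)) * (6 * H) ^ 4 ->
  Rabs (phi ^ 2 - y ^ 2) <= 100 / N -> y ^ 2 <= 1 ->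
  let kap := L ^ 3 / P in let del := 7016 * kap + tail_const / L in
  kap <= / 1000 -> 2 * del <= / 12 ->
  Rabs (Phi ^ 2 / (N * (Phi + Q) / 2 - Phi ^ 2) - / (/ 6 + y ^ 2 / 2)) <= 144 * del.
Proof.
move=> N3 L1 LN P0 [om0 om1] F0 FP [H0 H1] hQ hphi hy kap del hk hd.
have iP : 0 < / P by apply: Rinv_0_lt_compat.
have iN : 0 < / N by apply: Rinv_0_lt_compat; lra.
have iL : 0 < / L by apply: Rinv_0_lt_compat; lra.
have iNL : / N <= / L by apply: Rinv_le_contravar; lra.
have kapE : kap = L ^ 3 * / P by [].
have kap0 : 0 < kap by rewrite kapE; apply: Rmult_lt_0_compat => //; apply: pow_lt; lra.
have L2 : L <= L ^ 2 by nra.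
have L3 : L ^ 2 <= L ^ 3 by rewrite -[L ^ 3]/(L * L ^ 2); nra.
pose eta := (N - Phi) / N; pose psi := Q / N.
have eta0 : 0 <= eta by apply: Rdiv_le_0_compat; lra.
have eta1 : eta <= 2 * kap.
  have : eta <= om * / P.
    apply: (Rmult_le_reg_r (N * P)); first nra.
    have -> : eta * (N * P) = (N - Phi) * P by rewrite /eta; field; lra.
    have -> : om * / P * (N * P) = N * om by field; lra.
    done.
  have : om * / P <= 2 * L ^ 3 * / P by apply: Rmult_le_compat_r; lra.
  rewrite kapE; lra.
pose D := 72 * H ^ 2 / P.
have D0 : 0 <= D by apply: Rdiv_le_0_compat => //; nra.
have HL : H ^ 2 <= 4 * L ^ 2 by nra.
have D1 : D <= 288 * L ^ 2 * / P.
  by rewrite /D /Rdiv; apply: Rmult_le_compat_r; lra.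
have D2 : D <= 1.
  have : 288 * L ^ 2 * / P <= 288 * L ^ 3 * / P by apply: Rmult_le_compat_r; lra.
  rewrite kapE in hk; lra.
have omD : om * D <= 576 * kap.
  apply: Rle_trans (Rmult_le_compat om (2 * L) D (288 * L ^ 2 * / P) om0 D0 om1 D1) _.
  by rewrite kapE; apply: Req_le; ring.
have omDD : om * (6 * D * (D + 1)) <= 6912 * kap.
  have omD0 : 0 <= om * D by apply: Rmult_le_pos.
  have -> : om * (6 * D * (D + 1)) = 6 * (om * D) * (D + 1) by ring.
  nra.
have tail : exp (- (L / 8)) * (6 * H) ^ 4 <= 20736 * 40 ^ 5 / L.
  have e0 := exp_pos (- (L / 8)).
  have h4 : (6 * H) ^ 4 <= 20736 * L ^ 4.
    have -> : 20736 * L ^ 4 = (12 * L) ^ 4 by ring.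
    by apply: pow_incr; lra.
  have := ln_pow4_exp L1 => h5.
  have : exp (- (L / 8)) * (6 * H) ^ 4 <= exp (- (L / 8)) * (20736 * L ^ 4).
    by apply: Rmult_le_compat_l => //; lra.
  rewrite /Rdiv in h5 *; lra.
have hpsi : Rabs (psi - (phi ^ 2 + 4 / 3 - 4 / (3 * N ^ 2)))
   <= 6 * eta + om * (6 * D * (D + 1)) + exp (- (L / 8)) * (6 * H) ^ 4.
  have -> : psi - (phi ^ 2 + 4 / 3 - 4 / (3 * N ^ 2))
     = / N * (Q - N * (phi ^ 2 + 4 / 3 - 4 / (3 * N ^ 2))).
    by rewrite /psi; field; lra.
  rewrite Rabs_mult (Rabs_pos_eq (/ N)); last lra.
  apply: Rle_trans (Rmult_le_compat_l _ _ _ (Rlt_le _ _ iN) hQ) _.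
  by apply: Req_le; rewrite /eta /D; field; lra.
pose Y := / 6 + y ^ 2 / 2.
have Y01 : / 6 <= Y <= 2 / 3 by rewrite /Y; have := pow2_ge_0 y; lra.
have hN2 : 0 <= 4 / (3 * N ^ 2) <= 2 * / L.
  have N2 : N <= 3 * N ^ 2 by nra.
  have : / (3 * N ^ 2) <= / N by apply: Rinv_le_contravar; lra.
  have : 0 < / (3 * N ^ 2) by apply: Rinv_0_lt_compat; lra.
  have : 4 / (3 * N ^ 2) <= 2 * / N.
    have -> : 4 / (3 * N ^ 2) = (4 / 3 * / N) * / N by field; lra.
    have : / N <= 1 by rewrite -Rinv_1; apply: Rinv_le_contravar; lra.
    nra.
  rewrite /Rdiv; lra.
have hpsiY : Rabs (psi - (1 + 2 * Y)) <= 6924 * kap + tail_const / L.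
  have -> : psi - (1 + 2 * Y) = (psi - (phi ^ 2 + 4 / 3 - 4 / (3 * N ^ 2)))
     + (phi ^ 2 - y ^ 2) + - (4 / (3 * N ^ 2)) by rewrite /Y; field; lra.
  apply: Rle_trans (Rabs_triang _ _) _; rewrite Rabs_Ropp (Rabs_pos_eq (4 / _)); last lra.
  have := Rabs_triang (psi - (phi ^ 2 + 4 / 3 - 4 / (3 * N ^ 2))) (phi ^ 2 - y ^ 2).
  rewrite /tail_const /Rdiv in hphi tail *; rewrite /Rdiv in hN2 hpsi; lra.
have := @ratio_close eta psi Y (6924 * kap + tail_const / L).
have dd : 6924 * kap + tail_const / L + 8 * eta <= del by rewrite /del; lra.
case=> //; first by lra.
  by lra.
move=> X0 Xc.
set X := (_ / _ - 1) in X0 Xc.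
have Phi0 : Phi <> 0.
  have : Phi = N * (1 - eta) by rewrite /eta; field; lra.
  move=> pE e; have : N * (1 - eta) = 0 by rewrite -pE.
  nra.
have eX : Phi ^ 2 / (N * (Phi + Q) / 2 - Phi ^ 2) = / X.
  have XE : X = (N * (Phi + Q) / 2 - Phi ^ 2) / Phi ^ 2.
    rewrite /X /psi.
    have -> : 1 - eta = Phi / N by rewrite /eta; field; lra.
    by field; lra.
  have nz : N * (Phi + Q) / 2 - Phi ^ 2 <> 0.
    move=> e; move: X0; rewrite XE e /Rdiv Rmult_0_l; lra.
  by rewrite XE; field; split; lra.
rewrite eX; apply: Rle_trans Xc _.
by apply: Rmult_le_compat_l; lra.
Qed.

(** The bound [k <= 1/250000] will force the least prime factor above 250000; [14032 = 2 * 7016]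
    gives each summand of [del] half of [e1]. *)
Lemma choose_parameters (eps : R) : 0 < eps -> exists k B : R,
  [/\ 0 < k, k <= / 250000 & forall kap L, kap <= k -> 1 <= L -> B <= L ->
    let del := 7016 * kap + tail_const / L in 2 * del <= / 12 /\ 144 * del < eps].
Proof.
move=> e0; pose e1 := Rmin (eps / 145) (/ 24).
have e10 : 0 < e1 by rewrite /e1; apply: Rmin_pos; lra.
have e1a : e1 <= eps / 145 by exact: Rmin_l.
have e1b : e1 <= / 24 by exact: Rmin_r.
have tc : 0 < tail_const by rewrite /tail_const; lra.
exists (Rmin (/ 250000) (e1 / 14032)), (2 * tail_const / e1).
split; first by apply: Rmin_pos; lra.
  exact: Rmin_l.
move=> kap L hk L1 hB del.
have hk' : kap <= e1 / 14032 by apply: Rle_trans hk _; exact: Rmin_r.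
have hL : tail_const / L <= e1 / 2.
  apply: (Rmult_le_reg_r L); first lra.
  have -> : tail_const / L * L = tail_const by field; lra.
  have : 2 * tail_const / e1 * e1 <= L * e1 by apply: Rmult_le_compat_r; lra.
  have -> : 2 * tail_const / e1 * e1 = 2 * tail_const by field; lra.
  lra.
have : del <= e1 by rewrite /del; lra.
lra.
Qed.

From mathcomp Require Import all_fingroup all_solvable all_field.
From mathcomp Require Import ring lra.
Import Order.TTheory GRing.Theory Num.Theory.
Local Open Scope ring_scope.

(** * Character sums over finite fields *)

Section QuadraticCharacter.

Variable F : finFieldType.

Definition qchar (x : F) : int :=
  if x == 0 then 0 else if [exists y, y ^+ 2 == x] then 1 else -1.

Lemma qchar0 : qchar 0 = 0.
Proof. by rewrite /qchar eqxx. Qed.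

Lemma qchar_sqr (x : F) : x != 0 -> qchar x ^+ 2 = 1.
Proof. by rewrite /qchar => /negbTE->; case: ifP. Qed.

Lemma qchar_sqr_eq1 (x : F) : x != 0 -> qchar (x ^+ 2) = 1.
Proof.
move=> x0; rewrite /qchar expf_eq0 /= (negbTE x0).
by case: existsP => // -[]; exists x.
Qed.

Lemma qchar1 : qchar 1 = 1.
Proof. by rewrite -{1}(expr1n F 2) qchar_sqr_eq1 ?oner_eq0. Qed.

Lemma qchar_norm_le1 (x : F) : `|qchar x| <= 1.
Proof. by rewrite /qchar; case: ifP => // _; case: ifP. Qed.

Lemma qchar_cube (x : F) : qchar x ^+ 3 = qchar x.
Proof. by rewrite /qchar; case: ifP => // _; case: ifP. Qed.

Hypothesis oddF : odd #|F|.

(** The unit group is cyclic of even order, so being a square is the parity of an exponent;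
    multiplicativity and the vanishing of the full sum follow from this. *)
Lemma qchar_generator : exists2 g : F, g != 0 &
  (forall x, x != 0 -> exists k, x = g ^+ k) /\
  (forall k, qchar (g ^+ k) = (-1) ^+ k).
Proof.
have /cyclicP[g Hg] := field_unit_group_cyclic [set: {unit F}]%G.
have og : #[g]%g = #|F|.-1 by rewrite orderE -Hg card_finField_unit.
have gen (x : F) : x != 0 -> exists k, x = FinRing.uval g ^+ k.
  rewrite -unitfE => Ux.
  have : FinRing.Unit Ux \in <[g]>%g by rewrite -Hg inE.
  move=> /cycleP[k /(congr1 val)/= ->]; exists k; exact: FinRing.val_unitX.
have g0 : FinRing.uval g != 0 by rewrite -unitfE; exact: (valP g).
exists (FinRing.uval g) => //; split=> // k.
rewrite /qchar expf_eq0 (negbTE g0) andbF -signr_odd.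
have evF : ~~ odd #|F|.-1 by move: (finNzRing_gt1 F) oddF; lia.
case: existsP => [[y /eqP Hy]|H].
- have y0 : y != 0.
    apply/eqP => y0; move: Hy; rewrite y0 expr0n /= => /esym/eqP.
    by rewrite expf_eq0 (negbTE g0) andbF.
  have [l yE] := gen y y0; rewrite yE -exprM -!FinRing.val_unitX in Hy.
  have /eqP := val_inj Hy; rewrite eq_expg_mod_order og => /eqP /(congr1 odd).
  by rewrite !(odd_mod _ (negbTE evF)) oddM andbF => <-.
- case Hk : (odd k) => //; case: H; exists (FinRing.uval g ^+ k./2).
  by rewrite -exprM muln2 -[X in _ == _ ^+ X]odd_double_half Hk.
Qed.

Lemma qcharM (x y : F) : qchar (x * y) = qchar x * qchar y.
Proof.
have [->|x0] := eqVneq x 0; first by rewrite mul0r qchar0 mul0r.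
have [->|y0] := eqVneq y 0; first by rewrite mulr0 qchar0 mulr0.
have [g g0 [gen Hq]] := qchar_generator.
have [k ->] := gen _ x0; have [l ->] := gen _ y0.
by rewrite -exprD !Hq exprD.
Qed.

Lemma sum_qchar : \sum_(x : F) qchar x = 0.
Proof.
have [g g0 [gen Hq]] := qchar_generator.
have qg : qchar g = -1 by rewrite -[g]expr1 Hq.
have gK : bijective ( *%R g) by exists ( *%R g^-1) => x; rewrite ?mulKf ?mulVKf.
have : \sum_(x : F) qchar x = - \sum_(x : F) qchar x.
  rewrite [LHS](reindex _ (onW_bij _ gK)) /= -sumrN.
  by apply: eq_bigr => x _; rewrite qcharM qg mulN1r.
by move/eqP; rewrite -addr_eq0 -mulr2n mulrn_eq0 => /eqP.
Qed.

Lemma sum_qchar_affine (a b : F) : a != 0 -> \sum_(x : F) qchar (b + x * a) = 0.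
Proof.
move=> a0; rewrite -[RHS]sum_qchar.
have gK : bijective (fun x : F => b + x * a).
  exists (fun y => (y - b) / a) => x; first by rewrite addrC addKr mulfK.
  by rewrite divfK // addrC subrK.
by rewrite [RHS](reindex _ (onW_bij _ gK)).
Qed.

End QuadraticCharacter.

Lemma sum_pow4 (R : comNzRingType) (I : finType) (a : I -> R) :
  (\sum_i a i) ^+ 4 =
  \sum_i1 \sum_i2 \sum_i3 \sum_i4 a i1 * a i2 * a i3 * a i4.
Proof.
rewrite !exprS expr0 mulr1 mulr_suml; apply: eq_bigr => i1 _.
rewrite mulrCA mulr_suml; apply: eq_bigr => i2 _.
rewrite mulrA mulrCA mulr_suml; apply: eq_bigr => i3 _.
by rewrite mulrA mulr_sumr; apply: eq_bigr => i4 _; ring.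
Qed.

(** Equivalently, every value occurs an even number of times, so that the product of characters is a
    square and does not cancel. *)
Definition paired (T : eqType) (x1 x2 x3 x4 : T) : bool :=
  [|| (x1 == x2) && (x3 == x4), (x1 == x3) && (x2 == x4)
    | (x1 == x4) && (x2 == x3)].

Lemma paired_le_sum (T : eqType) (x1 x2 x3 x4 : T) :
  (paired x1 x2 x3 x4 <= (x1 == x2) * (x3 == x4) + (x1 == x3) * (x2 == x4)
    + (x1 == x4) * (x2 == x3))%N.
Proof. by rewrite /paired; do !case: eqP. Qed.

Lemma isolated_of_not_paired (T : eqType) (x1 x2 x3 x4 : T) :
  ~~ paired x1 x2 x3 x4 ->
  [\/ [/\ x1 != x2, x1 != x3 & x1 != x4], [/\ x2 != x1, x2 != x3 & x2 != x4],
      [/\ x3 != x1, x3 != x2 & x3 != x4] | [/\ x4 != x1, x4 != x2 & x4 != x3]].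
Proof.
rewrite /paired.
have [?|n12] := eqVneq x1 x2; [subst x2|];
(have [?|n13] := eqVneq x1 x3; [subst x3|]);
(have [?|n14] := eqVneq x1 x4; [subst x4|]);
try (have [?|n23] := eqVneq x2 x3; [subst x3|]);
try (have [?|n24] := eqVneq x2 x4; [subst x4|]);
try (have [?|n34] := eqVneq x3 x4; [subst x4|]);
rewrite ?eqxx ?andbF ?andbT ?orbT //= => _;
by first [by constructor 1; split; rewrite // eq_sym
         |by constructor 2; split; rewrite // eq_sym
         |by constructor 3; split; rewrite // eq_sym
         |by constructor 4; split; rewrite // eq_sym].
Qed.

Lemma sum_paired_le (T : finType) :
  (\sum_(x1 : T) \sum_(x2 : T) \sum_(x3 : T) \sum_(x4 : T) paired x1 x2 x3 x4
    <= 3 * #|T| ^ 2)%N.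
Proof.
have S1 (x : T) : (\sum_(y : T) (x == y) = 1)%N.
  rewrite (bigD1 x) //= eqxx big1 // => y.
  by rewrite eq_sym => /negbTE->.
have S2 (x : T) : (\sum_(y : T) (y == x) = 1)%N.
  by rewrite -[RHS](S1 x); apply: eq_bigr => y _; rewrite eq_sym.
apply: (@leq_trans (\sum_(x1 : T) \sum_(x2 : T) \sum_(x3 : T) \sum_(x4 : T)
  ((x1 == x2) * (x3 == x4) + (x1 == x3) * (x2 == x4)
    + (x1 == x4) * (x2 == x3))))%N.
  by do 4!(apply: leq_sum => ? _); exact: paired_le_sum.
under eq_bigr => x1 _.
  under eq_bigr => x2 _.
    under eq_bigr => x3 _.
      rewrite 2!big_split /= -!big_distrr -big_distrl /= !S1 !muln1 mul1n.
      over.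
    rewrite 2!big_split /= sum_nat_const !S1.
    over.
  rewrite 2!big_split /= -big_distrr /= S1 !sum_nat_const !muln1.
  over.
rewrite sum_nat_const; move: #|T| => k; nia.
Qed.

Section FourthMoment.

Variable F : finFieldType.
Hypothesis oddF : odd #|F|.
Local Notation q := #|F|.
Implicit Types (v : 'rV[F]_4) (y : F).

(** Degree at most 3 is the smallest bound for which the values at four distinct points are
    independent. *)
Definition ev v y := (rVpoly v).[y].

Lemma ev_translate v (L : {poly F}) (t y : F) : (size L <= 4)%N ->
  ev (v + t *: poly_rV L) y = ev v y + t * L.[y].
Proof.
by move=> sL; rewrite /ev addrC linearP /= poly_rV_K // hornerD hornerZ addrC.
Qed.

(* The value at [y1] can be moved freely while the values at the three other
   points stay fixed. *)
Lemma sum_isolated_eq0 y1 y2 y3 y4 : y1 != y2 -> y1 != y3 -> y1 != y4 ->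
  \sum_v qchar (ev v y1) * (qchar (ev v y2) * qchar (ev v y3) * qchar (ev v y4)) = 0.
Proof.
move=> n2 n3 n4.
set h := fun v => qchar (ev v y2) * qchar (ev v y3) * qchar (ev v y4).
rewrite -/(h _); set s := (LHS).
pose L : {poly F} := ('X - y2%:P) * ('X - y3%:P) * ('X - y4%:P).
have sL : (size L <= 4)%N.
  have -> : L = \prod_(y <- [:: y2; y3; y4]) ('X - y%:P).
    by rewrite !big_cons big_nil mulr1 mulrA.
  by rewrite size_prod_XsubC.
have L1 : L.[y1] != 0.
  by rewrite /L !hornerM !hornerXsubC !mulf_neq0 // subr_eq0.
have st (t : F) : s = \sum_v qchar (ev v y1 + t * L.[y1]) * h v.
  have bij : bijective (fun v => v + t *: poly_rV L).
    by exists (fun v => v - t *: poly_rV L) => v; rewrite ?addrK ?subrK.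
  rewrite /s (reindex _ (onW_bij _ bij)) /=; apply: eq_bigr => v _.
  rewrite ev_translate // /h !ev_translate //; congr (_ * _).
  by rewrite /L !hornerM !hornerXsubC !subrr !(mulr0, mul0r, addr0).
have : \sum_(t : F) s = 0.
  rewrite (eq_bigr _ (fun t _ => st t)) exchange_big big1 // => v _.
  by rewrite -mulr_suml sum_qchar_affine // mul0r.
rewrite sumr_const => /eqP; rewrite mulrn_eq0 => /orP[|/eqP//].
by rewrite -leqn0 leqNgt (leq_trans _ (finNzRing_gt1 F)).
Qed.

Lemma sum_quadruple_le y1 y2 y3 y4 :
  \sum_v qchar (ev v y1) * qchar (ev v y2) * qchar (ev v y3) * qchar (ev v y4)
    <= (q ^ 4 * paired y1 y2 y3 y4)%:R.
Proof.
case: (boolP (paired _ _ _ _)) => [_|/isolated_of_not_paired H].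
  apply: (@le_trans _ _ (\sum_(v : 'rV[F]_4) 1)).
    apply: ler_sum => v _; apply: le_trans (ler_norm _) _.
    by rewrite !normrM !mulr_ile1 // ?mulr_ge0 // qchar_norm_le1.
  by rewrite sumr_const card_mx mul1n muln1.
rewrite muln0 le_eqVlt; apply/orP; left; apply/eqP.
case: H => [[a b c]|[a b c]|[a b c]|[a b c]];
  rewrite -[RHS](sum_isolated_eq0 a b c); apply: eq_bigr => v _; ring.
Qed.

Lemma fourth_moment_le :
  \sum_v (\sum_y qchar (ev v y)) ^+ 4 <= (3 * q ^ 6)%:R.
Proof.
under eq_bigr => v _ do rewrite sum_pow4.
rewrite exchange_big /=; under eq_bigr => y1 _ do
  (rewrite exchange_big /=; under eq_bigr => y2 _ do
   (rewrite exchange_big /=; under eq_bigr => y3 _ do rewrite exchange_big /=)).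
apply: (@le_trans _ _ (\sum_(y1 : F) \sum_(y2 : F) \sum_(y3 : F) \sum_(y4 : F)
  (q ^ 4 * paired y1 y2 y3 y4)%:R)).
  by do 4!(apply: ler_sum => ? _); exact: sum_quadruple_le.
under eq_bigr => y1 _ do (under eq_bigr => y2 _ do
  (under eq_bigr => y3 _ do rewrite -natr_sum -big_distrr /=;
   rewrite -natr_sum -big_distrr /=); rewrite -natr_sum -big_distrr /=).
rewrite -natr_sum -big_distrr ler_nat /= (_ : 3 * q ^ 6 = q ^ 4 * (3 * q ^ 2))%N.
  by rewrite leq_mul2l sum_paired_le orbT.
by rewrite mulnCA -expnD.
Qed.

Lemma card_roots_le v : v != 0 -> (#|[pred r | root (rVpoly v) r]| <= 3)%N.
Proof.
move=> v0; have p0 : rVpoly v != 0.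
  by apply: contra v0 => /eqP e; rewrite -[v]rVpolyK e linear0.
have := @max_poly_roots _ (rVpoly v) (enum [pred r | root (rVpoly v) r]) p0.
rewrite enum_uniq -cardE => H.
rewrite -ltnS; apply: leq_trans (size_poly _ _); apply: H => //.
by apply/allP => r; rewrite mem_enum.
Qed.

(* The polynomials c * f(a y + b) have the same character sum as f up to sign,
   and each arises from at most 9 triples (c, a, b), because the triple is
   determined by the preimages of two given roots of f. *)
Lemma charsum_two_roots_le (f : {poly F}) (r1 r2 : F) :
  (size f <= 4)%N -> f != 0 -> root f r1 -> root f r2 -> r1 != r2 ->
  ((q.-1 * q.-1 * q)%N)%:R * (\sum_y qchar f.[y]) ^+ 4 <= (27 * q ^ 6)%:R :> int.
Proof.
move=> sf f0 f1 f2 n12.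
set T := \sum_y _.
pose g (t : F * F * F) : {poly F} := t.1.1 *: (f \Po (t.1.2 *: 'X + t.2%:P)).
have gE t y : (g t).[y] = t.1.1 * f.[t.1.2 * y + t.2].
  by rewrite /g hornerZ horner_comp hornerD hornerZ hornerX hornerC.
have sg t : (size (g t) <= 4)%N.
  apply: leq_trans (size_scale_leq _ _) _.
  apply: leq_trans (size_comp_poly_leq _ _) _.
  have : (size (t.1.2 *: 'X + t.2%:P : {poly F})%R <= 2)%N.
    apply: leq_trans (size_polyD _ _) _; rewrite geq_max.
    apply/andP; split; last by apply: leq_trans (size_polyC_leq1 _) _.
    by apply: leq_trans (size_scale_leq _ _) _; rewrite size_polyX.
  by move: (size _) (size f) sf => k [|l] //; nia.
pose Phi (t : F * F * F) : 'rV[F]_4 * F * F :=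
  (poly_rV (g t), (r1 - t.2) / t.1.2, (r2 - t.2) / t.1.2).
pose D := [set t : F * F * F | (t.1.1 != 0) && (t.1.2 != 0)].
pose E := [set z : 'rV[F]_4 * F * F | [&& z.1.1 != 0, root (rVpoly z.1.1) z.1.2
                                       & root (rVpoly z.1.1) z.2]].
pose G (z : 'rV[F]_4 * F * F) := (\sum_y qchar (ev z.1.1 y)) ^+ 4.
have G0 z : 0 <= G z by rewrite /G exprn_even_ge0.
have cD : #|D| = (q.-1 * q.-1 * q)%N.
  have -> : D = setX (setX [set~ 0] [set~ 0]) [set: F].
    by apply/setP => -[[c a] b]; rewrite !inE /= andbT.
  by rewrite !cardsX !cardsC1 cardsT.
have GT t : t \in D -> G (Phi t) = T ^+ 4.
  case: t => [[c a] b]; rewrite inE /= => /andP[c0 a0].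
  rewrite /G /ev /= poly_rV_K //.
  have bij : bijective (fun y => a * y + b).
    exists (fun y => (y - b) / a) => y; first by rewrite addrK mulrAC mulfV ?mul1r.
    by rewrite mulrC divfK // subrK.
  under eq_bigr => y _ do rewrite gE /= qcharM //.
  rewrite -mulr_sumr /T [in RHS](reindex _ (onW_bij _ bij)) /= exprMn.
  by rewrite (exprM _ 2 2) qchar_sqr // expr1n mul1r.
have PhiD t : t \in D -> Phi t \in E.
  case: t => [[c a] b]; rewrite inE /= => /andP[c0 a0].
  have h0 : g (c, a, b) != 0.
    rewrite /g scaler_eq0 (negbTE c0) /= -size_poly_eq0 size_comp_poly2 ?size_poly_eq0 //.
    by rewrite size_addl ?size_scale ?size_polyX // size_polyC; case: eqP.
  rewrite inE /= poly_rV_K // !rootE !gE /= ![a * _]mulrC !divfK // !subrK.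
  rewrite (rootP f1) (rootP f2) !mulr0 eqxx !andbT.
  by apply: contra h0 => /eqP e; rewrite -[g _](@poly_rV_K F 4) ?sg // e linear0.
have injPhi : {in D &, injective Phi}.
  move=> [[c a] b] [[c' a'] b']; rewrite !inE /= => /andP[c0 a0] /andP[c0' a0'].
  rewrite /Phi /= => -[eg e1 e2].
  have ea : a = a'.
    have : (r1 - r2) / a = (r1 - r2) / a'.
      rewrite [r1 - r2](_ : _ = (r1 - b) - (r2 - b)); last by ring.
      rewrite mulrBl e1 e2 -mulrBl; congr (_ / _); ring.
    by move/mulfI; rewrite subr_eq0 => /(_ n12)/invr_inj.
  have eb : b = b'.
    move: e1; rewrite ea => /mulIf; rewrite invr_eq0 => /(_ a0') /addrI /oppr_inj //.
  congr (_, _, _) => //; move: eg => /(congr1 rVpoly); rewrite !poly_rV_K //.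
  rewrite /g /= ea eb => /eqP; rewrite -subr_eq0 -scalerBl scaler_eq0 => /orP[].
    by rewrite subr_eq0 => /eqP.
  rewrite -size_poly_eq0 size_comp_poly2 ?size_poly_eq0 ?(negbTE f0) //.
  by rewrite size_addl ?size_scale ?size_polyX // size_polyC; case: eqP.
have -> : (q.-1 * q.-1 * q)%:R * T ^+ 4 = \sum_(z in Phi @: D) G z.
  rewrite (big_imset _ injPhi) /= (eq_bigr _ GT) sumr_const cD.
  by rewrite mulr_natl.
have subE : Phi @: D \subset E.
  by apply/subsetP => z /imsetP[t tD ->]; exact: PhiD.
have le1 : \sum_(z in Phi @: D) G z <= \sum_(z in E) G z.
  rewrite [leRHS](big_setID (Phi @: D)) /= (setIidPr subE) lerDl.
  by apply: sumr_ge0.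
apply: (le_trans le1); apply: (@le_trans _ _ (9 * \sum_v (\sum_y qchar (ev v y)) ^+ 4)); last first.
  rewrite (_ : (27 * q ^ 6)%:R = 9 * (3 * q ^ 6)%:R); last by rewrite !natrM; ring.
  by rewrite ler_pM2l // fourth_moment_le.
pose H v := (\sum_y qchar (ev v y)) ^+ 4.
rewrite mulr_sumr.
have -> : \sum_(z in E) G z = \sum_(v | v != 0) \sum_(r | root (rVpoly v) r)
                               \sum_(r' | root (rVpoly v) r') H v.
  rewrite pair_big_dep pair_big_dep /=; apply: eq_bigl => -[[v r] r'].
  by rewrite inE /= andbA.
rewrite [leRHS](bigID (fun v => v != 0)) /= -[leLHS]addr0 lerD //; last first.
  by apply: sumr_ge0 => v _; rewrite mulr_ge0 // exprn_even_ge0.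
apply: ler_sum => v v0; rewrite !sumr_const -mulrnA -[leLHS]mulr_natl.
rewrite ler_wpM2r ?exprn_even_ge0 // ler_nat.
by have := card_roots_le v0; move: #|_| => k; nia.
Qed.

End FourthMoment.

Section CorrelationBound.

Variable F : finFieldType.
Hypothesis oddF : odd #|F|.
Local Notation q := #|F|.

Lemma card_ge3 : (3 <= q)%N.
Proof. by have := finNzRing_gt1 F; move: oddF; case: q => [|[|[|n]]]. Qed.

Definition cubic_sum (a b c : F) : int :=
  \sum_y qchar ((1 + y * a) * (1 + y * b) * (1 + y * c)).

Lemma cubic_sumC12 a b c : cubic_sum a b c = cubic_sum b a c.
Proof. by apply: eq_bigr => y _; congr qchar; ring. Qed.

Lemma cubic_sumC23 a b c : cubic_sum a b c = cubic_sum a c b.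
Proof. by apply: eq_bigr => y _; congr qchar; ring. Qed.

(** The distinct roots are [-1/a] and [-1/b]. Since [4 q^2 <= 9 (q-1)^2] for [q >= 3], the bound
    [27 q^6 / ((q-1)^2 q)] becomes [243 q^3 / 4]. *)
Lemma cubic_sum_distinct a b c : a != 0 -> b != 0 -> a != b ->
  4 * cubic_sum a b c ^+ 4 <= (243 * q ^ 3)%:R.
Proof.
move=> a0 b0 ab.
pose l (t : F) : {poly F} := t *: 'X + 1.
pose f : {poly F} := l a * l b * l c.
have lE t y : (l t).[y] = 1 + y * t.
  by rewrite /l hornerD hornerZ hornerX hornerE addrC mulrC.
have sl t : (size (l t) <= 2)%N.
  apply: leq_trans (size_polyD _ _) _; rewrite size_poly1 geq_max andbT.
  by apply: leq_trans (size_scale_leq _ _) _; rewrite size_polyX.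
have l0 t : l t != 0.
  by apply/eqP => /(congr1 (fun p => p.[0])); rewrite lE horner0 mul0r addr0; apply/eqP; rewrite oner_eq0.
have sf : (size f <= 4)%N.
  rewrite /f !size_mul ?mulf_neq0 //.
  by move: (sl a) (sl b) (sl c); move: (size _) (size _) (size _) => i j k; lia.
have r t : t != 0 -> root (l t) (- t^-1).
  by move=> t0; rewrite rootE lE mulNr mulVf // subrr.
have fa : root f (- a^-1) by rewrite /f !rootM r.
have fb : root f (- b^-1) by rewrite /f !rootM [root (l b) _]r ?orbT.
have nab : - a^-1 != - b^-1 by rewrite eqr_opp (inj_eq invr_inj).
have f0 : f != 0 by rewrite /f !mulf_neq0.
have := charsum_two_roots_le oddF sf f0 fa fb nab.
have -> : \sum_y qchar f.[y] = cubic_sum a b c.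
  by apply: eq_bigr => y _; rewrite /f !hornerM !lE.
have := card_ge3; move: (cubic_sum a b c) => T q3 H.
have T4 : 0 <= T ^+ 4 by rewrite exprn_even_ge0.
move: (T ^+ 4) T4 H => U; move: q q3 => [//|m] m3 U0.
rewrite -pred_Sn (natrM _ 27) (natrM _ 243) !natrX !natrM => H.
have m3' : 3 <= m.+1%:R :> int by rewrite (ler_nat _ 3).
have e : m%:R = m.+1%:R - 1 :> int by rewrite -addn1 natrD addrK.
rewrite e in H; move: (m.+1%:R : int) m3' H => {e}k k3 H.
have h1 : 4 * k ^+ 2 <= 9 * ((k - 1) * (k - 1)) by nia.
have h2 : 4 * k ^+ 3 * U <= 243 * k ^+ 6.
  apply: (@le_trans _ _ (9 * ((k - 1) * (k - 1) * k * U))); last by nia.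
  have -> : 9 * ((k - 1) * (k - 1) * k * U) = 9 * ((k - 1) * (k - 1)) * (k * U) by ring.
  have -> : 4 * k ^+ 3 * U = 4 * k ^+ 2 * (k * U) by ring.
  by rewrite ler_wpM2r // mulr_ge0 //; lia.
have k0 : 0 < k ^+ 3 by rewrite exprn_gt0 //; lia.
rewrite -(ler_pM2l k0).
have -> : k ^+ 3 * (4 * U) = 4 * k ^+ 3 * U by ring.
by have -> : k ^+ 3 * (243 * k ^+ 3) = 243 * k ^+ 6 by ring.
Qed.

Lemma cubic_sum_aaa a : a != 0 -> cubic_sum a a a = 0.
Proof.
move=> a0; rewrite -[RHS](sum_qchar_affine oddF 1 a0); apply: eq_bigr => y _.
by rewrite !qcharM // -[RHS]qchar_cube; ring.
Qed.

Lemma cubic_sum_a00 a : a != 0 -> cubic_sum a 0 0 = 0.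
Proof.
move=> a0; rewrite -[RHS](sum_qchar_affine oddF 1 a0); apply: eq_bigr => y _.
by congr qchar; ring.
Qed.

(** Unless two of the parameters are distinct and nonzero, an unpaired quadruple has either exactly
    one nonzero parameter or three equal ones; there the character is that of a linear polynomial
    and the sum vanishes. *)
Lemma cubic_sum_le a b c : ~~ paired 0 a b c ->
  4 * cubic_sum a b c ^+ 4 <= (243 * q ^ 3)%:R.
Proof.
have z T : T = 0 -> 4 * T ^+ 4 <= (243 * q ^ 3)%:R :> int.
  by move=> ->; rewrite expr0n mulr0.
rewrite /paired.
have [?|a0] := eqVneq a 0; [subst a|]; (have [?|b0] := eqVneq b 0; [subst b|]);
(have [?|c0] := eqVneq c 0; [subst c|]); rewrite ?eqxx //= => H.
- by apply: z; rewrite cubic_sumC23 cubic_sumC12 cubic_sum_a00.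
- by apply: z; rewrite cubic_sumC12 cubic_sum_a00.
- by rewrite cubic_sumC12 cubic_sumC23 cubic_sum_distinct //; apply: contraNneq H => ->; rewrite ?eqxx ?orbT.
- by apply: z; rewrite cubic_sum_a00.
- by rewrite cubic_sumC23 cubic_sum_distinct //; apply: contraNneq H => ->; rewrite ?eqxx ?orbT.
- by rewrite cubic_sum_distinct //; apply: contraNneq H => ->; rewrite ?eqxx ?orbT.
- have [?|ab] := eqVneq a b; last exact: cubic_sum_distinct.
  have [?|ac] := eqVneq a c; last by rewrite cubic_sumC23 cubic_sum_distinct.
  by subst b c; apply: z; exact: cubic_sum_aaa.
Qed.

Definition correlation4 (x1 x2 x3 x4 : F) : int :=
  \sum_j qchar (j + x1) * qchar (j + x2) * qchar (j + x3) * qchar (j + x4).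

(* Substituting [j = 1/y] turns the quartic sum into a cubic one. *)
Lemma correlation4_cubic x1 x2 x3 x4 :
  correlation4 x1 x2 x3 x4 = cubic_sum (x2 - x1) (x3 - x1) (x4 - x1) - 1.
Proof.
have bij1 : bijective (fun j => j - x1).
  by exists (fun j => j + x1) => j; rewrite ?subrK ?addrK.
rewrite /correlation4 (reindex _ (onW_bij _ bij1)) /= (bigD1 0) //=.
(* The term [j = 0] vanishes, and the term [y = 0] of the cubic sum, which no [j] matches, is 1: it
   accounts for the [- 1]. *)
rewrite subrK qchar0 !mul0r add0r /cubic_sum [in RHS](bigD1 0) //= !mul0r !addr0 !mulr1 qchar1.
rewrite addrAC subrr add0r.
have bij2 : bijective (fun j : F => j^-1) by exists (fun j => j^-1) => j; rewrite invrK.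
rewrite (reindex _ (onW_bij _ bij2)) /=.
apply: eq_big => [y|y]; first by rewrite invr_eq0.
rewrite invr_eq0 => y0; rewrite -!qcharM //.
(* The character of [y^4] is 1, so the denominators can be cleared. *)
rewrite -[LHS]mul1r -(@qchar_sqr_eq1 _ (y ^+ 2)) ?expf_eq0 // -qcharM //.
congr qchar; field.
by rewrite y0.
Qed.

(** From [(T-1)^4 <= 8 (T^4 + 1)] the bound is [486 q^3 + 8], which 500 absorbs. *)
Lemma correlation4_le x1 x2 x3 x4 : ~~ paired x1 x2 x3 x4 ->
  correlation4 x1 x2 x3 x4 ^+ 4 <= (500 * q ^ 3)%:R.
Proof.
move=> np; rewrite correlation4_cubic.
have np' : ~~ paired 0 (x2 - x1) (x3 - x1) (x4 - x1).
  apply: contra np; rewrite /paired ![0 == _]eq_sym !subr_eq0 !(inj_eq (addIr _)).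
  by rewrite (eq_sym x2 x1) (eq_sym x3 x1) (eq_sym x4 x1).
have := cubic_sum_le np'; move: (cubic_sum _ _ _) => T.
have := card_ge3; move: q => k k3; rewrite (natrM _ 243) (natrM _ 500) !natrX => H.
have k3' : 3 <= k%:R :> int by rewrite (ler_nat _ 3).
move: (k%:R : int) k3' H => {k k3}k k3 H.
have h : (T - 1) ^+ 4 <= 8 * (T ^+ 4 + 1).
  rewrite -subr_ge0.
  have -> : 8 * (T ^+ 4 + 1) - (T - 1) ^+ 4 = (T + 1) ^+ 4 + 6 * (T ^+ 2 - 1) ^+ 2.
    ring.
  by apply: addr_ge0; [|apply: mulr_ge0 => //]; apply: exprn_even_ge0.
have k27 : 27 <= k ^+ 3 by rewrite (_ : 27 = 3 ^+ 3) // lerXn2r // ?nnegrE; lia.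
apply: (le_trans h); move: (T ^+ 4) (k ^+ 3) H k27 => U K; lia.
Qed.

End CorrelationBound.

(** * Correlations of the Jacobi symbol *)

Section PeriodicSums.

Variable V : comNzRingType.

Lemma sum_mod_reindex (n : nat) (h : nat -> nat) (f : nat -> V) : (0 < n)%N ->
  (forall i j, h i = h j %[mod n] -> i = j %[mod n]) ->
  \sum_(j < n) f (h j %% n)%N = \sum_(j < n) f j.
Proof.
move=> n0 hinj; pose H (j : 'I_n) : 'I_n := Ordinal (ltn_pmod (h j) n0).
have Hb : bijective H.
  apply: inj_card_bij => // i j /(congr1 val) /= /hinj.
  by rewrite !modn_small // => /val_inj.
by rewrite [RHS](reindex _ (onW_bij _ Hb)).
Qed.

Lemma sum_shift (n a : nat) (f : nat -> V) : (0 < n)%N ->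
  (forall j, f (j %% n)%N = f j) -> \sum_(j < n) f (j + a)%N = \sum_(j < n) f j.
Proof.
move=> n0 per; rewrite -(@sum_mod_reindex n (addn^~ a)) //.
  by apply: eq_bigr => j _; rewrite per.
by move=> i j /eqP; rewrite eqn_modDr => /eqP.
Qed.

Lemma sum_dilate (n k : nat) (f : nat -> V) : (0 < n)%N -> coprime n k ->
  (forall j, f (j %% n)%N = f j) -> \sum_(j < n) f (j * k)%N = \sum_(j < n) f j.
Proof.
move=> n0 nk per; rewrite -(@sum_mod_reindex n (muln^~ k)) //.
  by apply: eq_bigr => j _; rewrite per.
move=> i j /eqP H; apply/eqP; move: H; wlog ij : i j / (i <= j)%N => [W|].
  by case/orP: (leq_total i j) => l H; [|rewrite eq_sym]; apply: W => //; rewrite eq_sym.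
rewrite eq_sym [in X in _ -> X]eq_sym !eqn_mod_dvd ?leq_mul2r ?ij ?orbT //.
by rewrite -mulnBl Gauss_dvdl.
Qed.

Lemma sum_crt (m p : nat) (f g : nat -> V) : (0 < m)%N -> (0 < p)%N ->
  coprime m p ->
  \sum_(j < m * p) f (j %% m)%N * g (j %% p)%N
    = (\sum_(j < m) f j) * (\sum_(j < p) g j).
Proof.
move=> m0 p0 mp; rewrite big_distrlr pair_big /=.
pose H (j : 'I_(m * p)) : 'I_m * 'I_p :=
  (Ordinal (ltn_pmod j m0), Ordinal (ltn_pmod j p0)).
have Hb : bijective H.
  apply: inj_card_bij; last by rewrite card_prod !card_ord.
  move=> i j [/eqP e1 /eqP e2]; apply: val_inj => /=.
  have : i == j %[mod m * p] by rewrite chinese_remainder // e1.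
  by rewrite !modn_small // => /eqP.
by rewrite [RHS](reindex _ (onW_bij _ Hb)).
Qed.

Lemma sum_crt_prod (s : seq nat) (f : nat -> nat -> V) :
  uniq s -> all prime s ->
  \sum_(j < \prod_(p <- s) p) \prod_(p <- s) f p (j %% p)%N
    = \prod_(p <- s) \sum_(j < p) f p j.
Proof.
elim: s => [|p s IH] /=; first by rewrite !big_nil big_ord1 big_nil.
case/andP=> ps us /andP[pp als].
set m := (\prod_(r <- s) r)%N.
have m0 : (0 < m)%N.
  by rewrite /m big_seq prodn_cond_gt0 // => r /(allP als)/prime_gt0.
have cop : coprime p m.
  rewrite /m big_seq; elim/big_ind: _ => [|x y|r rs]; first exact: coprimen1.
    by rewrite coprimeMr => -> ->.
  have pr : prime r by exact: (allP als).
  rewrite prime_coprime // dvdn_prime2 //.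
  by apply: contraNneq ps => ->.
rewrite !big_cons -/m -IH // -/m.
rewrite -(sum_crt (f p) (fun j => \prod_(r <- s) f r (j %% r)%N)) ?(prime_gt0 pp) //.
apply: eq_bigr => j _; rewrite big_cons; congr (_ * _).
rewrite big_seq [RHS]big_seq; apply: eq_bigr => r rs.
by rewrite modn_dvdm // /m (big_rem r) //= dvdn_mulr.
Qed.

End PeriodicSums.

Lemma sum_Fp (V : nmodType) (p : nat) (f : 'F_p -> V) : prime p ->
  \sum_(j < p) f (j%:R) = \sum_(x : 'F_p) f x.
Proof.
move=> pp; pose h (j : 'I_p) : 'F_p := (val j)%:R.
have hb : bijective h.
  apply: inj_card_bij; last by rewrite card_Fp // card_ord.
  move=> i j /(congr1 val) /=; rewrite /h !val_Fp_nat //.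
  by rewrite (modn_small (ltn_ord i)) (modn_small (ltn_ord j)) => /val_inj.
by rewrite [RHS](reindex _ (onW_bij _ hb)).
Qed.

Lemma natr_Fp_eq (p a b : nat) : prime p ->
  ((a%:R : 'F_p) == b%:R) = (a == b %[mod p]).
Proof. by move=> pp; rewrite -val_eqE /= !val_Fp_nat. Qed.

Definition leg (p a : nat) : int := qchar (a%:R : 'F_p).

Lemma leg_mod (p a : nat) : prime p -> leg p (a %% p) = leg p a.
Proof. by move=> pp; rewrite /leg Fp_nat_mod. Qed.

Lemma odd_card_Fp (p : nat) : prime p -> odd p -> odd #|'F_p|.
Proof. by move=> pp; rewrite card_Fp. Qed.

Lemma legM (p a b : nat) : prime p -> odd p -> leg p (a * b) = leg p a * leg p b.
Proof. by move=> pp po; rewrite /leg natrM qcharM ?odd_card_Fp. Qed.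

Lemma leg_sqr (p a : nat) : prime p -> leg p a ^+ 2 = (~~ (p %| a)%N)%:R.
Proof.
move=> pp; rewrite /leg.
have -> : (p %| a)%N = (a%:R == 0 :> 'F_p) by rewrite -[0]/(0%:R) natr_Fp_eq // mod0n.
by case: eqVneq => [->|/qchar_sqr->//]; rewrite qchar0.
Qed.

Lemma sum_leg (p : nat) : prime p -> odd p -> \sum_(j < p) leg p j = 0.
Proof. by move=> pp po; rewrite sum_Fp // sum_qchar // odd_card_Fp. Qed.

Lemma legendreE (a p : nat) : prime p -> 
  IZR (legendre a p) = (leg p a)%:~R.
Proof.
move=> pp; rewrite /legendre /leg /qchar.
have -> : (p %| a)%N = (a%:R == 0 :> 'F_p) by rewrite -[0]/(0%:R) natr_Fp_eq // mod0n.
case: ifP => // _.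
have -> : has (fun x => (x * x) %% p == a %% p)%N (iota 0 p)
          = [exists y : 'F_p, y ^+ 2 == a%:R].
  apply/hasP/existsP => [[x _ H]|[y /eqP H]].
    by exists x%:R; rewrite -natrX natr_Fp_eq // -mulnn.
  exists (val y).
    by rewrite mem_iota /= add0n; have := ltn_ord y; rewrite {2}Fp_cast.
  by rewrite mulnn -natr_Fp_eq // natrX natr_Zp H.
by case: ifP.
Qed.

(** The exponents in [jacobi] are all 1 for square-free [n]; integer values allow casts into both
    [R] and [R[i]]. *)
Definition chi (n j : nat) : int := \prod_(p <- primes n) leg p j.

Section Jacobi.

Variable n : nat.
Hypotheses (nodd : odd n) (nsf : squarefree n) (n1 : (1 < n)%N).

Let n0 : (0 < n)%N. Proof. exact: ltnW. Qed.

Lemma primes_odd p : p \in primes n -> odd p.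
Proof.
rewrite mem_primes => /and3P[_ _ /dvdnP[k nE]].
by move: nodd; rewrite nE oddM => /andP[].
Qed.

Lemma primes_prime p : p \in primes n -> prime p.
Proof. by rewrite mem_primes => /andP[]. Qed.

Lemma squarefree_logn p : p \in primes n -> logn p n = 1%N.
Proof.
move=> pn; have pp := primes_prime pn.
have l1 : (0 < logn p n)%N by rewrite logn_gt0.
have : ~~ (1 < logn p n)%N.
  rewrite -pfactor_dvdn // expnS expn1; apply/negP; exact: nsf.
by lia.
Qed.

Lemma squarefree_prod : n = (\prod_(p <- primes n) p)%N.
Proof.
rewrite {1}(prod_prime_decomp n0) prime_decompE big_map.
rewrite big_seq [RHS]big_seq; apply: eq_bigr => p pn /=.
by rewrite squarefree_logn // expn1.
Qed.

Lemma squarefree_cofactor p : p \in primes n ->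
  (n %/ p * p = n)%N /\ coprime (n %/ p) p.
Proof.
move=> pn; have pp := primes_prime pn.
have dn : (n %/ p * p = n)%N.
  by apply: divnK; move: pn; rewrite mem_primes => /and3P[].
split=> //; rewrite coprime_sym prime_coprime //; apply/negP => pd.
by apply: (nsf pp); rewrite -dn dvdn_pmul2r ?prime_gt0.
Qed.

Lemma chi_mod j : chi n (j %% n) = chi n j.
Proof.
rewrite /chi big_seq [RHS]big_seq; apply: eq_bigr => p pn.
rewrite -leg_mod ?primes_prime // modn_dvdm ?leg_mod ?primes_prime //.
by move: pn; rewrite mem_primes => /and3P[].
Qed.

Lemma chiM i j : chi n (i * j) = chi n i * chi n j.
Proof.
rewrite /chi -big_split /= big_seq [RHS]big_seq; apply: eq_bigr => p pn.
by rewrite legM ?primes_prime ?primes_odd.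
Qed.

Lemma chi_sqr j : chi n j ^+ 2 = (coprime n j)%:R.
Proof.
rewrite /chi -prodrXl big_seq.
have -> : \prod_(p <- primes n | p \in primes n) leg p j ^+ 2
   = \prod_(p <- primes n | p \in primes n) (~~ (p %| j)%N)%:R.
  by apply: eq_bigr => p pn; rewrite leg_sqr ?primes_prime.
rewrite -big_seq.
have -> : coprime n j = all (fun p => ~~ (p %| j)%N) (primes n).
  case: (posnP j) => [->|j0].
    rewrite /coprime gcdn0; rewrite (_ : (n == 1%N) = false); last by lia.
    apply/esym/negbTE; rewrite -has_predC; apply/hasP.
    by exists (pdiv n); [rewrite mem_primes pdiv_prime // n0 pdiv_dvd|rewrite /= dvdn0].
  rewrite coprime_has_primes // -all_predC; apply/idP/idP => /allP H; apply/allP => p pn.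
    have := primes_prime pn; apply: contraL => pj.
    apply/negP => pp; move: (H p); rewrite /= mem_primes pp j0 pj /= => /(_ isT)/negP.
    by apply.
  rewrite /=; apply/negP => pn'.
  by have := H p pn'; move: pn; rewrite mem_primes => /and3P[_ _ ->].
elim: (primes n) => [|p s IH]; first by rewrite big_nil.
by rewrite big_cons IH /=; case: (p %| j)%N; rewrite ?mul0r ?mul1r.
Qed.

Lemma jacobiE (j : nat) : IZR (jacobi j n) = (chi n j)%:~R.
Proof.
have H s : {subset s <= primes n} ->
  IZR (foldr (fun p acc => Z.mul (Z.pow (legendre j p) (Z.of_nat (logn p n))) acc)
        (Zpos xH) s) = (\prod_(p <- s) leg p j)%:~R.
  elim: s => [|p s IH] sub; first by rewrite big_nil.
  have pn : p \in primes n by apply: sub; rewrite inE eqxx.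
  rewrite /= mult_IZR IH; last by move=> r rs; apply: sub; rewrite inE rs orbT.
  by rewrite squarefree_logn // Z.pow_1_r legendreE ?primes_prime // big_cons intrM.
exact: H.
Qed.

Definition corr4 (x1 x2 x3 x4 : nat) : int :=
  \sum_(j < n) chi n (j + x1) * chi n (j + x2) * chi n (j + x3) * chi n (j + x4).

Lemma corr4_prod x1 x2 x3 x4 :
  corr4 x1 x2 x3 x4 = \prod_(p <- primes n)
    correlation4 (x1%:R : 'F_p) (x2%:R : 'F_p) (x3%:R : 'F_p) (x4%:R : 'F_p).
Proof.
pose f p j := leg p (j + x1) * leg p (j + x2) * leg p (j + x3) * leg p (j + x4).
have fE p j : prime p -> f p (j %% p)%N = f p j.
  by move=> pp; rewrite /f /leg !natrD Fp_nat_mod.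
have : \sum_(j < \prod_(p <- primes n) p) \prod_(p <- primes n) f p (j %% p)%N
    = \prod_(p <- primes n) \sum_(j < p) f p j.
  by apply: sum_crt_prod; [exact: primes_uniq | exact/allP/primes_prime].
rewrite -squarefree_prod => H; transitivity (\prod_(p <- primes n) \sum_(j < p) f p j).
  rewrite -H; apply: eq_bigr => j _; rewrite /chi -!big_split /=.
  by rewrite big_seq [RHS]big_seq; apply: eq_bigr => p /primes_prime pp; rewrite fE.
rewrite big_seq [RHS]big_seq; apply: eq_bigr => p /primes_prime pp.
rewrite -[RHS]sum_Fp //; apply: eq_bigr => j _.
by rewrite /f /leg !natrD.
Qed.

(** Locally [c^8 <= 500^2 p^6 <= p^7], so no constant survives in the product over the primes.
    Eighth powers keep the statement in the integers. *)
Lemma corr4_nondegenerate x1 x2 x3 x4 :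
  (forall p, p \in primes n -> (250000 <= p)%N) ->
  (forall p, p \in primes n ->
     ~~ paired (x1 %% p)%N (x2 %% p)%N (x3 %% p)%N (x4 %% p)%N) ->
  corr4 x1 x2 x3 x4 ^+ 8 <= (n ^ 7)%:R.
Proof.
move=> big np; rewrite corr4_prod -prodrXl {2}squarefree_prod.
have -> : ((\prod_(p <- primes n) p) ^ 7)%:R = \prod_(p <- primes n) ((p ^ 7)%:R : int).
  by rewrite natrX natr_prod -prodrXl; apply: eq_bigr => p _; rewrite natrX.
rewrite big_seq [leRHS]big_seq; apply: ler_prod => p pn.
have pp := primes_prime pn; rewrite exprn_even_ge0 //=.
set c := correlation4 _ _ _ _.
have : c ^+ 4 <= (500 * p ^ 3)%:R.
  rewrite -[p in (500 * p ^ 3)%N](card_Fp pp); apply: correlation4_le.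
    exact/odd_card_Fp/primes_odd.
  by have := np p pn; rewrite /paired !natr_Fp_eq.
have -> : c ^+ 8 = (c ^+ 4) ^+ 2 by rewrite -exprM.
have c0 : 0 <= c ^+ 4 by rewrite exprn_even_ge0.
move=> h; apply: (@le_trans _ _ ((500 * p ^ 3)%:R ^+ 2)).
  by rewrite lerXn2r // nnegrE ler0n.
rewrite -natrX ler_nat expnMn -expnM.
have -> : (p ^ 7 = p * p ^ 6)%N by rewrite -expnS.
by rewrite leq_mul2r (leq_trans _ (big p pn)) ?orbT.
Qed.

Definition nunits : int := \sum_(j < n) chi n j ^+ 2.

Lemma chi_sqr_le1 j : chi n j ^+ 2 <= 1.
Proof. by rewrite chi_sqr lern1 leq_b1. Qed.

Lemma chi_norm_le1 j : `|chi n j| <= 1.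
Proof.
rewrite -(@ler_pXn2r _ 2) ?nnegrE // expr1n -normrX ger0_norm ?chi_sqr_le1 //.
by rewrite exprn_even_ge0.
Qed.

Lemma nunits_le : nunits <= n%:R.
Proof.
rewrite /nunits -[leRHS]mulr1 mulr_natl -[in leRHS](card_ord n) -sumr_const.
by apply: ler_sum => j _; exact: chi_sqr_le1.
Qed.

Lemma sum_chi_sqr_shift x : \sum_(j < n) chi n (j + x) ^+ 2 = nunits.
Proof. by rewrite (@sum_shift _ n x (fun j => chi n j ^+ 2)) // => j; rewrite chi_mod. Qed.

Lemma corr4_le x1 x2 x3 x4 : `|corr4 x1 x2 x3 x4| <= n%:R.
Proof.
apply: le_trans (ler_norm_sum _ _ _) _.
rewrite -[leRHS]mulr1 mulr_natl -[in leRHS](card_ord n) -sumr_const.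
apply: ler_sum => j _; rewrite !normrM.
by rewrite !mulr_ile1 ?mulr_ge0 ?normr_ge0 ?chi_norm_le1.
Qed.

(** Termwise this is [ab >= a + b - 1] for two indicators of units. *)
Lemma corr4_xxyy_ge x y : 2 * nunits - n%:R <= corr4 x x y y.
Proof.
rewrite mulr2n mulrDl mul1r -{1}(sum_chi_sqr_shift x) -(sum_chi_sqr_shift y).
rewrite -[n%:R]mulr1 mulr_natl -[in X in _ - X](card_ord n) -sumr_const -big_split -sumrB /=.
apply: ler_sum => j _; rewrite !chi_sqr.
rewrite -mulrA -!expr2 !chi_sqr.
by case: (coprime n (j + x)); case: (coprime n (j + y)).
Qed.

Lemma corr4_paired x1 x2 x3 x4 : paired x1 x2 x3 x4 ->
  `|corr4 x1 x2 x3 x4 - n%:R| <= 2 * (n%:R - nunits).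
Proof.
move=> H; have {H} : exists x y, corr4 x1 x2 x3 x4 = corr4 x x y y.
  case/or3P: H => /andP[/eqP-> /eqP->].
  - by exists x2, x4.
  - by exists x3, x4; apply: eq_bigr => j _; ring.
  - by exists x4, x3; apply: eq_bigr => j _; ring.
case=> x [y ->]; have := corr4_xxyy_ge x y; have := corr4_le x x y y.
rewrite ler_norml => /andP[_ h1] h2; rewrite ler_norml; move: (corr4 _ _ _ _) nunits nunits_le h1 h2.
by move=> a b c d e; apply/andP; split; lia.
Qed.

(** Union bound: each prime [p] dividing [n] accounts for [n/p <= n/P] non-units. *)
Lemma nonunits_le P : (0 < P)%N -> (forall p, p \in primes n -> (P <= p)%N) ->
  (n%:R - nunits) * P%:R <= (n * size (primes n))%:R.
Proof.
move=> P0 HP.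
have -> : n%:R - nunits = \sum_(j < n) (~~ coprime n j)%:R.
  rewrite /nunits -[n%:R]mulr1 mulr_natl -[in X in X - _](card_ord n) -sumr_const -sumrB.
  by apply: eq_bigr => j _; rewrite chi_sqr; case: coprime.
apply: (@le_trans _ _ ((\sum_(j < n) \sum_(p <- primes n) (p %| j)%N%:R) * P%:R)).
  rewrite ler_wpM2r // ler_sum // => j _.
  rewrite -natr_sum ler_nat; case: (boolP (coprime n j)) => //= nc.
  have [p pn pj] : exists2 p, p \in primes n & (p %| j)%N.
    exists (pdiv (gcdn n j)).
      rewrite mem_primes n0 pdiv_prime ?(dvdn_trans (pdiv_dvd _)) ?dvdn_gcdl //.
      by move: nc; rewrite /coprime; have := gcdn_gt0 n j; rewrite n0; case: gcdn => [|[]].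
    exact: dvdn_trans (pdiv_dvd _) (dvdn_gcdr _ _).
  by rewrite (big_rem p) //= pj.
have E (s : seq nat) : (n * size s)%:R = \sum_(p <- s) (n%:R : int).
  elim: s => [|p s IH]; first by rewrite muln0 big_nil.
  by rewrite big_cons -IH /= mulnS natrD.
rewrite exchange_big /= mulr_suml E big_seq [leRHS]big_seq.
apply: ler_sum => p pn; have pp := primes_prime pn.
have [dn cop] := squarefree_cofactor pn.
have -> : \sum_(j < n) (p %| j)%N%:R = (n %/ p)%:R :> int.
  transitivity (\sum_(j < n %/ p * p) (1 : int) * ((j %% p == 0)%N%:R : int)).
    by rewrite dn; apply: eq_bigr => j _; rewrite mul1r.
  rewrite (sum_crt (fun=> 1) (fun j => (j == 0)%N%:R)) ?(prime_gt0 pp) //.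
    rewrite sumr_const card_ord [X in _ * X](_ : _ = 1) ?mulr1 //.
    rewrite (bigD1 (Ordinal (prime_gt0 pp))) //= big1 ?addr0 // => j.
    by rewrite -val_eqE /= => /negbTE->.
  by rewrite divn_gt0 ?(prime_gt0 pp) // dvdn_leq // -dn dvdn_mull.
by rewrite -natrM ler_nat -{2}dn leq_mul2l HP ?orbT.
Qed.

End Jacobi.

(** * Gauss sums and interpolation *)

Section Fourier.

Variables (C : numClosedFieldType) (n : nat) (z : C).
Hypotheses (n0 : (0 < n)%N) (zn : z ^+ n = -1) (prim : n.-primitive_root (z ^+ 2)).
Local Notation w := (z ^+ 2).

Lemma root_norm1 : `|z| = 1.
Proof.
have : `|z| ^+ n = 1 by rewrite -normrX zn normrN1.
by move/eqP; rewrite pexpr_eq1 // => /eqP.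
Qed.

Lemma root_conj : z^* * z = 1.
Proof. by rewrite mulrC -normCK root_norm1 expr1n. Qed.

Lemma wn1 : w ^+ n = 1.
Proof. by rewrite exprAC zn expr2 mulN1r opprK. Qed.

Lemma w_mod j : w ^+ (j %% n) = w ^+ j.
Proof. exact: prim_expr_mod. Qed.

Lemma sum_root_powers k : \sum_(x < n) w ^+ (k * x) = if (n %| k)%N then n%:R else 0.
Proof.
case: ifP => [/dvdnP[l ->]|nk].
  under eq_bigr => x _ do rewrite -mulnA mulnCA exprM wn1 expr1n.
  by rewrite sumr_const card_ord.
under eq_bigr => x _ do rewrite exprM.
have := subrX1 (w ^+ k) n; rewrite [(w ^+ k) ^+ n]exprAC wn1 expr1n subrr => /esym/eqP.
by rewrite mulf_eq0 subr_eq0 -(prim_order_dvd prim) nk => /eqP.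
Qed.

Lemma parseval (c : nat -> C) :
  \sum_(x < n) `|\sum_(k < n) c k * w ^+ (k * x)| ^+ 2 = n%:R * \sum_(k < n) `|c k| ^+ 2.
Proof.
have wc (l x : nat) : (l <= n)%N -> (w ^+ (l * x))^* = w ^+ ((n - l) * x).
  move=> ln; apply: (@mulIf _ (w ^+ (l * x))).
    by rewrite expf_neq0 // expf_neq0 // -normr_eq0 root_norm1 oner_eq0.
  rewrite -exprD -mulnDl subnK // [RHS]exprM wn1 expr1n.
  by rewrite !rmorphXn /= -!exprMn root_conj !expr1n.
transitivity (\sum_(x < n) \sum_(k < n) \sum_(l < n)
    (c k * (c l)^*) * w ^+ ((k + (n - l)) * x)).
  apply: eq_bigr => x _; rewrite normCK mulr_suml; apply: eq_bigr => k _.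
  rewrite rmorph_sum mulr_sumr; apply: eq_bigr => l _.
  by rewrite rmorphM /= wc ?(ltnW (ltn_ord l)) // mulnDl exprD; ring.
rewrite exchange_big mulr_sumr /=; apply: eq_bigr => k _.
rewrite exchange_big (bigD1 k) //= [X in _ + X]big1 ?addr0 => [|l lk].
  rewrite -mulr_sumr sum_root_powers subnKC ?(ltnW (ltn_ord k)) // dvdnn.
  by rewrite normCK mulrC.
rewrite -mulr_sumr sum_root_powers ifF ?mulr0 //; apply: contraNF lk => d.
have hk := ltn_ord k; have hl := ltn_ord l; apply/eqP/val_inj => /=.
have /dvdnP[q e] := d; have : (0 < q < 2)%N by nia.
by nia.
Qed.

(** The Lagrange kernel carrying values at the [n]-th roots to the odd [2n]-th roots; as a geometric
    sum it is [-2 / (z^(2x+1) - 1)]. *)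
Definition kern (x : nat) : C := \sum_(k < n) z ^+ (k * (2 * x + 1)).

Lemma odd_power_n x : (z ^+ (2 * x + 1)) ^+ n = -1.
Proof. by rewrite exprAC zn exprD expr1 exprM sqrrN expr1n expr1n mul1r. Qed.

Lemma kernM x : (z ^+ (2 * x + 1) - 1) * kern x = -2.
Proof.
rewrite /kern; set y := z ^+ _.
under eq_bigr => k _ do rewrite mulnC exprM -/y.
by rewrite -subrX1 odd_power_n; ring.
Qed.

Lemma odd_power_neq1 x : z ^+ (2 * x + 1) - 1 != 0.
Proof.
apply/eqP => e; have := kernM x; rewrite e mul0r => /eqP.
by rewrite eq_sym oppr_eq0 pnatr_eq0.
Qed.

(** Expanding the square, [v+1] pairs [(k, l)] have [k + l = v], and [n-1-v] pairs have
    [k + l = v + n] and enter with sign -1, because the [n]-th power of [z^(2x+1)] is -1. The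
    difference is [2v + 2 - n]. *)
Lemma kern_sqr x :
  kern x ^+ 2 = \sum_(v < n) (2 * v%:R + 2 - n%:R) * z ^+ (v * (2 * x + 1)).
Proof.
apply: (mulfI (odd_power_neq1 x)).
rewrite expr2 mulrA kernM /kern; set y := z ^+ _.
under eq_bigr => k _ do rewrite mulnC exprM -/y.
under [in RHS]eq_bigr => k _ do rewrite mulnC exprM -/y.
have H (m : nat) (d : C) : (y - 1) * \sum_(v < m) (2 * v%:R + 2 - d) * y ^+ v
   = (2 * m%:R - d) * y ^+ m + d - 2 * \sum_(v < m) y ^+ v.
  elim: m => [|m IH]; first by rewrite !big_ord0; ring.
  rewrite !big_ord_recr /= !mulrDr IH exprS -addn1 natrD; ring.
rewrite H odd_power_n; ring.
Qed.

Lemma kern_w x : kern x = \sum_(k < n) z ^+ k * w ^+ (k * x).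
Proof. by apply: eq_bigr => k _; rewrite -exprM -exprD; congr (_ ^+ _); lia. Qed.

Lemma kern_sqr_w x : kern x ^+ 2 =
  \sum_(v < n) ((2 * v%:R + 2 - n%:R) * z ^+ v) * w ^+ (v * x).
Proof.
rewrite kern_sqr; apply: eq_bigr => k _; rewrite -mulrA -exprM -exprD.
by congr (_ * _ ^+ _); lia.
Qed.

Lemma sum_kern_norm2 : \sum_(x < n) `|kern x| ^+ 2 = n%:R ^+ 2.
Proof.
under eq_bigr => x _ do rewrite kern_w.
rewrite (parseval (fun k => z ^+ k)) expr2; congr (_ * _).
under eq_bigr => k _ do rewrite normrX root_norm1 !expr1n.
by rewrite sumr_const card_ord.
Qed.

(** Parseval for the expansion of [kern x ^+ 2], which again has only [n] frequencies. *)
Lemma sum_kern_norm4 :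
  \sum_(x < n) `|kern x| ^+ 4 = n%:R * ((n%:R ^+ 3 + 2 * n%:R) / 3).
Proof.
under eq_bigr => x _ do rewrite (exprM _ 2 2) -normrX kern_sqr_w.
rewrite (parseval (fun v => (2 * v%:R + 2 - n%:R) * z ^+ v)); congr (_ * _).
transitivity (\sum_(k < n) (2 * k%:R + 2 - n%:R) ^+ 2 : C).
  apply: eq_bigr => k _; rewrite normrM normrX root_norm1 expr1n mulr1.
  apply: real_normK.
  by apply: rpredB; [apply: rpredD; [apply: rpredM|]|]; apply: realn.
have H (m : nat) (d : C) : \sum_(v < m) (2 * v%:R + 2 - d) ^+ 2
   = (4 * m%:R ^+ 3 + 6 * m%:R ^+ 2 + 2 * m%:R) / 3 - 2 * d * m%:R * (m%:R + 1)
     + m%:R * d ^+ 2.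
  elim: m => [|m IH]; first by rewrite big_ord0; field.
  by rewrite big_ord_recr /= IH -addn1 natrD; field.
by rewrite H; field.
Qed.

(** Orthogonality keeps only the frequency congruent to [-2s]; the rotation enters the main term
    through this coefficient alone. *)
Lemma sum_twisted_kern_sqr (s v : nat) : (v < n)%N -> (n %| v + 2 * s)%N ->
  \sum_(x < n) w ^+ (2 * s * x) * kern x ^+ 2
    = n%:R * ((2 * v%:R + 2 - n%:R) * z ^+ v).
Proof.
move=> vn vs.
transitivity (\sum_(x < n) \sum_(k < n)
    ((2 * k%:R + 2 - n%:R) * z ^+ k) * w ^+ ((k + 2 * s) * x)).
  apply: eq_bigr => x _; rewrite kern_sqr_w mulr_sumr; apply: eq_bigr => k _.
  by rewrite mulrCA -exprD -mulnDl addnC.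
rewrite exchange_big (bigD1 (Ordinal vn)) //= [X in _ + X]big1 ?addr0 => [|k kv].
  by rewrite -mulr_sumr sum_root_powers vs mulrC.
rewrite -mulr_sumr sum_root_powers ifF ?mulr0 //; apply: contraNF kv => d.
apply/eqP/val_inj => /=.
have := ltn_ord k => kn.
have e : (k + 2 * s == v + 2 * s %[mod n])%N by rewrite !(eqP d) !(eqP vs).
by move: e; rewrite eqn_modDr !modn_small // => /eqP.
Qed.

Hypotheses (nodd : odd n) (nsf : squarefree n) (n1 : (1 < n)%N).

Local Notation ch j := ((chi n j)%:~R : C).

Definition gauss : C := \sum_(m < n) ch m * w ^+ m.

(** For [k] prime to [n], dilate the summation variable. Otherwise take a prime [p] dividing both:
    [w^(mk)] depends only on [m] modulo [n/p], and the Chinese remainder theorem splits off the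
    vanishing sum of [leg p]. Square-freeness makes [n/p] prime to [p]. *)
Lemma chi_gauss k : \sum_(m < n) ch m * w ^+ (m * k) = ch k * gauss.
Proof.
case: (boolP (coprime n k)) => cnk.
  have kk : ch k * ch k = 1 by rewrite -intrM -expr2 chi_sqr // cnk.
  have per j : ch (j %% n) * w ^+ (j %% n) = ch j * w ^+ j.
    by rewrite chi_mod // w_mod.
  rewrite /gauss -(@sum_dilate _ n k (fun j => ch j * w ^+ j)) // mulr_sumr.
  apply: eq_bigr => m _; rewrite chiM // intrM.
  by rewrite mulrA [ch k * _]mulrCA kk mulr1.
have X0 : ch k = 0.
  by apply/eqP; rewrite -sqrf_eq0 -rmorphXn /= chi_sqr // (negbTE cnk).
rewrite X0 mul0r.
have [p pn pk] : exists2 p, p \in primes n & (p %| k)%N.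
  exists (pdiv (gcdn n k)); last exact: dvdn_trans (pdiv_dvd _) (dvdn_gcdr _ _).
  rewrite mem_primes n0 pdiv_prime ?(dvdn_trans (pdiv_dvd _)) ?dvdn_gcdl //.
  by move: cnk; rewrite /coprime; have := gcdn_gt0 n k; rewrite n0; case: gcdn => [|[]].
have pp := primes_prime pn; have [dn cop] := squarefree_cofactor nsf pn.
set m := (n %/ p)%N in dn cop.
pose f j := (\prod_(r <- rem p (primes n)) leg r j)%:~R * w ^+ (j * k).
have fE j : f (j %% m)%N = f j.
  rewrite /f; congr (_%:~R * _).
    rewrite big_seq [RHS]big_seq; apply: eq_bigr => r rr.
    have rn := mem_rem rr; have pr := primes_prime rn.
    rewrite -[RHS]leg_mod // -leg_mod // modn_dvdm //.
    have : (r %| m * p)%N by rewrite dn; move: rn; rewrite mem_primes => /and3P[].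
    rewrite Euclid_dvdM // => /orP[//|]; rewrite dvdn_prime2 // => /eqP rp.
    by move: rr; rewrite rp mem_rem_uniqF ?primes_uniq.
  rewrite {2}(divn_eq j m) mulnDl exprD.
  rewrite [X in _ = X * _](_ : _ = 1) ?mul1r //.
  have /dvdnP[l ->] := pk.
  have -> : (j %/ m * m * (l * p) = n * (j %/ m * l))%N by rewrite -dn; lia.
  by rewrite exprM wn1 expr1n.
transitivity (\sum_(j < m * p) f (j %% m)%N * (leg p (j %% p))%:~R).
  rewrite dn; apply: eq_bigr => j _; rewrite fE leg_mod // /f /chi (big_rem p) //=.
  by rewrite intrM; ring.
rewrite (sum_crt f (fun j => (leg p j)%:~R)) ?(prime_gt0 pp) //.
  by rewrite -rmorph_sum /= sum_leg ?(primes_odd nodd pn) // mulr0.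
by have := n0; rewrite -dn muln_gt0 => /andP[].
Qed.

(** Parseval applied to [chi_gauss]: both sides carry the factor [nunits n], which is positive. *)
Lemma gauss_norm2 : `|gauss| ^+ 2 = n%:R.
Proof.
have H := parseval (fun k => ch k).
have e : \sum_(x < n) `|\sum_(k < n) ch k * w ^+ (k * x)| ^+ 2
   = (nunits n)%:~R * `|gauss| ^+ 2.
  rewrite /nunits rmorph_sum mulr_suml; apply: eq_bigr => x _.
  by rewrite chi_gauss normrM exprMn -intr_norm -rmorphXn /= -normrX ger0_norm // exprn_even_ge0.
have e2 : \sum_(k < n) `|ch k| ^+ 2 = (nunits n)%:~R.
  rewrite /nunits rmorph_sum; apply: eq_bigr => x _.
  by rewrite -intr_norm -rmorphXn /= -normrX ger0_norm // exprn_even_ge0.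
move: H; rewrite e e2 mulrC => /mulIf; apply.
rewrite intr_eq0 /nunits (bigD1 (Ordinal n1)) //=.
rewrite chi_sqr // coprimen1 gt_eqF // ltr_pwDl // sumr_ge0 // => j _.
by rewrite exprn_even_ge0.
Qed.

Variable s : nat.

Definition amp (x : nat) : C := w ^+ (x * s) * kern x / n%:R.

Lemma value_even j : `|\sum_(k < n) ch (k + s) * z ^+ (k * (2 * j))| ^+ 2 = n%:R * ch j ^+ 2.
Proof.
have -> : \sum_(k < n) ch (k + s) * z ^+ (k * (2 * j))
   = (w ^+ (s * j))^-1 * \sum_(k < n) ch (k + s) * w ^+ ((k + s) * j).
  rewrite mulr_sumr; apply: eq_bigr => k _; rewrite mulnDl exprD.
  have -> : z ^+ (k * (2 * j)) = w ^+ (k * j) by rewrite -exprM; congr (_ ^+ _); lia.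
  have nz : w ^+ (s * j) != 0.
    by rewrite !expf_neq0 // -normr_eq0 root_norm1 oner_eq0.
  by field.
rewrite (@sum_shift _ n s (fun m => ch m * w ^+ (m * j))) //; last first.
  move=> m; rewrite chi_mod //; congr (_ * _).
  by rewrite -[LHS]w_mod modnMml w_mod.
rewrite chi_gauss !normrM normfV !normrX root_norm1 !expr1n invr1 mul1r exprMn gauss_norm2.
by rewrite mulrC real_normK // realz.
Qed.

Lemma value_odd i : `|\sum_(k < n) ch (k + s) * z ^+ (k * (2 * i + 1))| ^+ 2
  = n%:R * `|\sum_(x < n) ch (i.+1 + x) * amp x| ^+ 2.
Proof.
set B := \sum_(k < n) _; set u := \sum_(x < n) _.
have z0 : z != 0 by rewrite -normr_eq0 root_norm1 oner_eq0.
have zc (k : nat) : (z ^+ k)^* = (z ^+ k)^-1.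
  apply: (@mulIf _ (z ^+ k)); first by rewrite expf_neq0.
  by rewrite mulVf ?expf_neq0 // rmorphXn /= -exprMn root_conj expr1n.
have : gauss * B^* = w ^+ (i.+1 * s) * (n%:R * u).
  have -> : B^* = \sum_(k < n) ch (k + s) * (z ^+ (k * (2 * i + 1)))^-1.
    by rewrite rmorph_sum; apply: eq_bigr => k _; rewrite rmorphM /= zc rmorph_int.
  pose h m := ch m * w ^+ (m * s) * \sum_(k < n) w ^+ (m * k) * (z ^+ (k * (2 * i + 1)))^-1.
  have hper m : h (m %% n)%N = h m.
    have wm k : w ^+ (m %% n * k) = w ^+ (m * k).
      by rewrite -w_mod modnMml w_mod.
    by rewrite /h chi_mod // wm; congr (_ * _); apply: eq_bigr => k _; rewrite wm.
  transitivity (\sum_(m < n) h m).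
    rewrite mulr_sumr.
    transitivity (\sum_(k < n) \sum_(m < n)
       ch m * w ^+ (m * (k + s)) * (z ^+ (k * (2 * i + 1)))^-1).
      apply: eq_bigr => k _; rewrite -mulr_suml chi_gauss; ring.
    rewrite exchange_big; apply: eq_bigr => m _; rewrite /h mulr_sumr.
    by apply: eq_bigr => k _; rewrite mulnDr exprD; ring.
  (* The shift is [i+1] because [2(i+1+x) - (2i+1) = 2x+1], the exponent in [kern]. *)
  rewrite -(sum_shift i.+1 n0 hper) /u mulr_sumr mulr_sumr; apply: eq_bigr => x _.
  rewrite /h /amp /kern addnC mulnDl exprD.
  have -> : \sum_(k < n) w ^+ ((i.+1 + x) * k) / z ^+ (k * (2 * i + 1))
     = \sum_(k < n) z ^+ (k * (2 * x + 1)).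
    apply: eq_bigr => k _; apply: (@mulIf _ (z ^+ (k * (2 * i + 1)))).
      by rewrite expf_neq0.
    rewrite divfK ?expf_neq0 // -exprM -exprD; congr (_ ^+ _); lia.
  by field; rewrite pnatr_eq0; lia.
move/(congr1 (fun t => `|t| ^+ 2)); rewrite !normrM !normrX root_norm1 !expr1n mul1r.
rewrite norm_conjC !exprMn gauss_norm2 normr_nat expr2 -mulrA => /mulfI; apply.
by rewrite pnatr_eq0; lia.
Qed.

Lemma sum_values_pow4 : \sum_(t < 2 * n) `|\sum_(k < n) ch (k + s) * z ^+ (k * t)| ^+ 4
  = n%:R ^+ 2 * (nunits n)%:~R
    + n%:R ^+ 2 * \sum_(j < n) `|\sum_(x < n) ch (j + x) * amp x| ^+ 4.
Proof.
pose f t := `|\sum_(k < n) ch (k + s) * z ^+ (k * t)| ^+ 4.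
have split m : \sum_(t < 2 * m) f t = \sum_(i < m) f (2 * i)%N + \sum_(i < m) f (2 * i + 1)%N.
  elim: m => [|m IH]; first by rewrite !big_ord0 addr0.
  rewrite mulnS !addSn add0n !big_ord_recr /= IH addn1; ring.
rewrite (split n) /f; congr (_ + _).
  rewrite /nunits rmorph_sum mulr_sumr; apply: eq_bigr => j _.
  rewrite (exprM _ 2 2) value_even exprMn; congr (_ * _).
  by rewrite -!rmorphXn /= chi_sqr // ; case: coprime; rewrite ?expr1n ?expr0n.
have per m : `|\sum_(x < n) ch (m %% n + x) * amp x| ^+ 4 = `|\sum_(x < n) ch (m + x) * amp x| ^+ 4.
  congr (`|_| ^+ _); apply: eq_bigr => x _; congr (_%:~R * _).
  by rewrite -chi_mod // modnDml chi_mod.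
rewrite -(sum_shift 1 n0 per) mulr_sumr; apply: eq_bigr => i _.
by rewrite (exprM _ 2 2) value_odd exprMn -exprM addn1.
Qed.

End Fourier.

(** * Fourth powers as sums over quadruples *)

Section QuadrupleSums.

Variables (V : comNzRingType) (I : finType).
Implicit Types (F G : I -> I -> V).

Definition sum2 F : V := \sum_x \sum_y F x y.

Definition sum4 (H : I -> I -> I -> I -> V) : V :=
  \sum_x1 \sum_x2 \sum_x3 \sum_x4 H x1 x2 x3 x4.

Lemma eq_sum4 H H' : (forall x1 x2 x3 x4, H x1 x2 x3 x4 = H' x1 x2 x3 x4) ->
  sum4 H = sum4 H'.
Proof. by move=> e; do 4!(apply: eq_bigr => ? _). Qed.

Lemma sum4_12_34 F G :
  sum4 (fun x1 x2 x3 x4 => F x1 x2 * G x3 x4) = sum2 F * sum2 G.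
Proof.
rewrite /sum4 /sum2 mulr_suml; apply: eq_bigr => x1 _.
rewrite mulr_suml; apply: eq_bigr => x2 _.
by rewrite mulr_sumr; apply: eq_bigr => x3 _; rewrite mulr_sumr.
Qed.

Lemma sum4_13_24 F G :
  sum4 (fun x1 x2 x3 x4 => F x1 x3 * G x2 x4) = sum2 F * sum2 G.
Proof. by rewrite -sum4_12_34; apply: eq_bigr => x1 _; rewrite exchange_big. Qed.

Lemma sum4_14_23 F G :
  sum4 (fun x1 x2 x3 x4 => F x1 x4 * G x2 x3) = sum2 F * sum2 G.
Proof.
rewrite -sum4_13_24; apply: eq_bigr => x1 _; apply: eq_bigr => x2 _.
by rewrite exchange_big.
Qed.

Lemma sum4D H H' : sum4 (fun x1 x2 x3 x4 => H x1 x2 x3 x4 + H' x1 x2 x3 x4)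
  = sum4 H + sum4 H'.
Proof.
rewrite /sum4 -big_split; apply: eq_bigr => x1 _; rewrite -big_split; apply: eq_bigr => x2 _.
by rewrite -big_split; apply: eq_bigr => x3 _; rewrite -big_split.
Qed.

Lemma sum4Z c H : sum4 (fun x1 x2 x3 x4 => c * H x1 x2 x3 x4) = c * sum4 H.
Proof.
rewrite /sum4 mulr_sumr; apply: eq_bigr => x1 _; rewrite mulr_sumr; apply: eq_bigr => x2 _.
by rewrite mulr_sumr; apply: eq_bigr => x3 _; rewrite mulr_sumr.
Qed.

Lemma sum_diag (F : I -> V) x : \sum_y F y * (x == y)%:R = F x.
Proof.
rewrite (bigD1 x) //= eqxx mulr1 big1 ?addr0 // => y.
by rewrite eq_sym => /negbTE->; rewrite mulr0.
Qed.

Lemma sum2_diag F : sum2 (fun x y => F x y * (x == y)%:R) = \sum_x F x x.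
Proof. by apply: eq_bigr => x _; rewrite (sum_diag (F x)). Qed.

(** Inclusion-exclusion: two different pairings hold together only when all four entries agree, and
    that case is counted three times. *)
Lemma paired_ring (x1 x2 x3 x4 : I) : (paired x1 x2 x3 x4)%:R =
  (x1 == x2)%:R * (x3 == x4)%:R + (x1 == x3)%:R * (x2 == x4)%:R
  + (x1 == x4)%:R * (x2 == x3)%:R
  + -2 * ((x1 == x2)%:R * (x1 == x3)%:R * (x1 == x4)%:R) :> V.
Proof.
rewrite /paired.
have [?|n12] := eqVneq x1 x2; [subst x2|];
(have [?|n13] := eqVneq x1 x3; [subst x3|]);
(have [?|n14] := eqVneq x1 x4; [subst x4|]);
rewrite ?eqxx ?(negbTE n12) ?(negbTE n13) ?(negbTE n14) ?[_ == x1]eq_sym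
  ?(negbTE n12) ?(negbTE n13) ?(negbTE n14) /= ?mulr0 ?mul0r ?addr0 ?mulr1 ?orbF ?andbF ?andbT //=; ring.
Qed.

End QuadrupleSums.

(** Each pair congruent modulo [q] is either equal or strictly off-diagonal, and not both pairs are
    equal. With the coefficient 2 the total weight factors as [6 * offdiag q * (offdiag q + N2)]. *)
Lemma paired_mod_le n q (x1 x2 x3 x4 : 'I_n) :
  let e (x y : 'I_n) := x == y in
  let t (x y : 'I_n) := (x != y) && (x == y %[mod q]) in
  (paired (x1 %% q)%N (x2 %% q)%N (x3 %% q)%N (x4 %% q)%N && ~~ paired x1 x2 x3 x4
  <= 2 * (t x1 x2 * t x3 x4 + t x1 x3 * t x2 x4 + t x1 x4 * t x2 x3)
   + (t x1 x2 * e x3 x4 + t x1 x3 * e x2 x4 + t x1 x4 * e x2 x3)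
   + (e x1 x2 * t x3 x4 + e x1 x3 * t x2 x4 + e x1 x4 * t x2 x3))%N.
Proof.
rewrite /paired /=.
have imp (x y : 'I_n) : x == y -> (x %% q == y %% q)%N by move/eqP->.
move: (imp x1 x2) (imp x3 x4) (imp x1 x3) (imp x2 x4) (imp x1 x4) (imp x2 x3).
case: (x1 == x2); case: (x1 %% q == x2 %% q)%N => //=; try by move/(_ isT).
all: case: (x3 == x4); case: (x3 %% q == x4 %% q)%N => //=; try by move=> _ /(_ isT).
all: case: (x1 == x3); case: (x1 %% q == x3 %% q)%N => //=; try by move=> _ _ /(_ isT).
all: case: (x2 == x4); case: (x2 %% q == x4 %% q)%N => //=; try by move=> _ _ _ /(_ isT).
all: case: (x1 == x4); case: (x1 %% q == x4 %% q)%N => //=; try by move=> _ _ _ _ /(_ isT).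
all: by case: (x2 == x3); case: (x2 %% q == x3 %% q)%N => //=; move=> _ _ _ _ _ /(_ isT).
Qed.

Section PowerFour.

Variables (C : numClosedFieldType) (n : nat) (v : nat -> C).
Local Notation s4 := (@sum4 C 'I_n).

Definition quad (x1 x2 x3 x4 : 'I_n) : C := v x1 * v x2 * (v x3)^* * (v x4)^*.

Lemma sum_pow4_corr : \sum_(j < n) `|\sum_(x < n) (chi n (j + x))%:~R * v x| ^+ 4
  = s4 (fun x1 x2 x3 x4 => quad x1 x2 x3 x4 * (corr4 n x1 x2 x3 x4)%:~R).
Proof.
transitivity (\sum_(j < n) s4 (fun x1 x2 x3 x4 => quad x1 x2 x3 x4 *
   (chi n (j + x1) * chi n (j + x2) * chi n (j + x3) * chi n (j + x4))%:~R)).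
  apply: eq_bigr => j _; set u := \sum_(x < n) _.
  have -> : `|u| ^+ 4 = u * u * u^* * u^*.
    by rewrite (exprM _ 2 2) normCK; ring.
  have -> : u^* = \sum_(x < n) (chi n (j + x))%:~R * (v x)^*.
    by rewrite rmorph_sum; apply: eq_bigr => x _; rewrite rmorphM /= rmorph_int.
  pose a x := (chi n (j + x))%:~R * v x; pose b x := (chi n (j + x))%:~R * (v x)^*.
  transitivity (sum2 (fun x y : 'I_n => a x * a y) * sum2 (fun x y : 'I_n => b x * b y)).
    by rewrite -mulrA /sum2 /u; congr (_ * _); rewrite big_distrlr.
  rewrite -sum4_12_34; apply: eq_sum4 => x1 x2 x3 x4; rewrite /a /b.
  by rewrite /quad !intrM; ring.
rewrite /sum4 exchange_big; apply: eq_bigr => x1 _; rewrite exchange_big; apply: eq_bigr => x2 _.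
rewrite exchange_big; apply: eq_bigr => x3 _; rewrite exchange_big; apply: eq_bigr => x4 _.
by rewrite /corr4 rmorph_sum mulr_sumr.
Qed.

(** The pairing of 1 with 2 multiplies unconjugated factors and gives the phase-dependent term; the
    other two match each weight with a conjugate. *)
Lemma sum_quad_paired : s4 (fun x1 x2 x3 x4 => quad x1 x2 x3 x4 * (paired x1 x2 x3 x4)%:R)
  = `|\sum_(x < n) v x ^+ 2| ^+ 2 + 2 * (\sum_(x < n) `|v x| ^+ 2) ^+ 2
    - 2 * \sum_(x < n) `|v x| ^+ 4.
Proof.
pose e (x y : 'I_n) : C := (x == y)%:R.
transitivity (s4 (fun x1 x2 x3 x4 =>
   (v x1 * v x2 * e x1 x2) * ((v x3)^* * (v x4)^* * e x3 x4)
   + (v x1 * (v x3)^* * e x1 x3) * (v x2 * (v x4)^* * e x2 x4)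
   + (v x1 * (v x4)^* * e x1 x4) * (v x2 * (v x3)^* * e x2 x3)
   + -2 * (quad x1 x2 x3 x4 * (e x1 x2 * e x1 x3 * e x1 x4)))).
  by apply: eq_sum4 => x1 x2 x3 x4; rewrite paired_ring /quad /e; ring.
rewrite !sum4D sum4Z (sum4_12_34 (fun x y : 'I_n => v x * v y * e x y) (fun x y : 'I_n => (v x)^* * (v y)^* * e x y)).
rewrite (sum4_13_24 (fun x y : 'I_n => v x * (v y)^* * e x y) (fun x y : 'I_n => v x * (v y)^* * e x y)).
rewrite (sum4_14_23 (fun x y : 'I_n => v x * (v y)^* * e x y) (fun x y : 'I_n => v x * (v y)^* * e x y)).
rewrite /e !sum2_diag.
have e2 : \sum_(x < n) v x * (v x)^* = \sum_(x < n) `|v x| ^+ 2.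
  by apply: eq_bigr => x _; rewrite normCK.
have -> : s4 (fun x1 x2 x3 x4 => quad x1 x2 x3 x4 * ((x1 == x2)%:R * (x1 == x3)%:R * (x1 == x4)%:R))
   = \sum_(x < n) `|v x| ^+ 4.
  apply: eq_bigr => x _.
  transitivity (\sum_(y < n) v x * v y * (v x)^* * (v x)^* * (x == y)%:R).
    apply: eq_bigr => y _.
    transitivity (\sum_(t < n) v x * v y * (v t)^* * (v x)^* * (x == y)%:R * (x == t)%:R).
      apply: eq_bigr => t _.
      rewrite -[RHS](sum_diag (fun r : 'I_n => v x * v y * (v t)^* * (v r)^* * (x == y)%:R * (x == t)%:R)).
      by apply: eq_bigr => r _; rewrite /quad; ring.
    by rewrite (sum_diag (fun t : 'I_n => v x * v y * (v t)^* * (v x)^* * (x == y)%:R)).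
  rewrite (sum_diag (fun y : 'I_n => v x * v y * (v x)^* * (v x)^*)).
  by rewrite (exprM _ 2 2) normCK; ring.
have -> : \sum_(x < n) v x * v x = \sum_(x < n) v x ^+ 2.
  by apply: eq_bigr => x _; rewrite expr2.
have -> : \sum_(x < n) (v x)^* * (v x)^* = (\sum_(x < n) v x ^+ 2)^*.
  by rewrite rmorph_sum; apply: eq_bigr => x _; rewrite rmorphXn /= expr2.
rewrite e2 -normCK; ring.
Qed.

Lemma norm_sum4_le (H : 'I_n -> 'I_n -> 'I_n -> 'I_n -> C) :
  `|s4 H| <= s4 (fun x1 x2 x3 x4 => `|H x1 x2 x3 x4|).
Proof.
do 4!(apply: le_trans (ler_norm_sum _ _ _) _; apply: ler_sum => ? _).
exact: lexx.
Qed.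

Lemma sum_pow4_corr_main :
  `|\sum_(j < n) `|\sum_(x < n) (chi n (j + x))%:~R * v x| ^+ 4
    - n%:R * (`|\sum_(x < n) v x ^+ 2| ^+ 2 + 2 * (\sum_(x < n) `|v x| ^+ 2) ^+ 2
    - 2 * \sum_(x < n) `|v x| ^+ 4)|
  <= s4 (fun x1 x2 x3 x4 => `|v x1| * `|v x2| * `|v x3| * `|v x4|
          * (`|corr4 n x1 x2 x3 x4 - n%:R * (paired x1 x2 x3 x4)%:R|)%:~R).
Proof.
rewrite sum_pow4_corr -sum_quad_paired -sum4Z -mulN1r -sum4Z -sum4D.
apply: le_trans (norm_sum4_le _) _.
do 4!(apply: ler_sum => ? _).
rewrite le_eqVlt; apply/orP; left; apply/eqP.
rewrite intr_norm intrB intrM !mulrz_nat.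
rewrite mulN1r mulrCA -mulrBr normrM /quad !normrM !norm_conjC.
by [].
Qed.

End PowerFour.

Section ErrorBound.

Variables (R : realFieldType) (n : nat) (h : nat -> R) (E : R).
Hypotheses (nodd : odd n) (nsf : squarefree n) (n1 : (1 < n)%N).
Hypotheses (big : forall p, p \in primes n -> (250000 <= p)%N).
Hypotheses (h0 : forall x, 0 <= h x) (E0 : 0 <= E) (E8 : n%:R ^+ 7 <= E ^+ 8).
Local Notation s4 := (@sum4 R 'I_n).

Definition offdiag (q : nat) : R :=
  sum2 (fun x y : 'I_n => h x * h y * ((x != y) && (x == y %[mod q]))%:R).

(** Three cases: paired, where only non-units cost; paired modulo some [q] only, where the trivial
    bound [n] is used; and unpaired modulo every prime, where [E] applies. *)
Lemma corr4_error_le (x1 x2 x3 x4 : 'I_n) :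
  (`|corr4 n x1 x2 x3 x4 - n%:R * (paired x1 x2 x3 x4)%:R|)%:~R
  <= 2 * (n%:R - (nunits n)%:~R) * (paired x1 x2 x3 x4)%:R
     + n%:R * \sum_(q <- primes n)
         ((paired (x1 %% q)%N (x2 %% q)%N (x3 %% q)%N (x4 %% q)%N)
            && ~~ paired x1 x2 x3 x4)%:R + E :> R.
Proof.
case: (boolP (paired x1 x2 x3 x4)) => [P|nP].
  rewrite !mulr1 big1 ?mulr0 ?addr0; last by move=> *; rewrite andbF.
  apply: (@le_trans _ _ (2 * (n%:R - nunits n))%:~R).
    by rewrite ler_int; apply: corr4_paired.
  by rewrite intrM intrB !mulrz_nat lerDl.
rewrite !mulr0 subr0 add0r.
case: (boolP (has (fun q => paired (x1 %% q)%N (x2 %% q)%N (x3 %% q)%N (x4 %% q)%N) (primes n))).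
  case/hasP => q qn Pq; apply: (@le_trans _ _ n%:R).
    by have := corr4_le nodd n1 x1 x2 x3 x4; rewrite -(ler_int R) !mulrz_nat.
  rewrite (big_rem q) //= Pq /= mulrDr mulr1 -addrA lerDl addr_ge0 //.
  by rewrite mulr_ge0 // sumr_ge0.
rewrite -all_predC => /allP np; rewrite -[leLHS]add0r lerD ?mulr_ge0 ?sumr_ge0 //.
have := corr4_nondegenerate nodd nsf n1 big np.
rewrite -(ler_int R) => H.
rewrite -(@ler_pXn2r _ 8) ?nnegrE ?ler0z //.
apply: le_trans E8; rewrite -natrX; move: H; rewrite intr_norm -normrX ger0_norm ?exprn_even_ge0 //.
by rewrite rmorphXn /= mulrz_nat.
Qed.

Let N2 : R := \sum_(x < n) h x ^+ 2.

Lemma error_bound :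
  s4 (fun x1 x2 x3 x4 => h x1 * h x2 * h x3 * h x4
          * (`|corr4 n x1 x2 x3 x4 - n%:R * (paired x1 x2 x3 x4)%:R|)%:~R)
  <= 6 * (n%:R - (nunits n)%:~R) * N2 ^+ 2
     + n%:R * \sum_(q <- primes n) 6 * offdiag q * (offdiag q + N2)
     + E * (\sum_(x < n) h x) ^+ 4.
Proof.
pose e (x y : 'I_n) : R := (x == y)%:R.
pose t q (x y : 'I_n) : R := ((x != y) && (x == y %[mod q]))%:R.
have e0 x y : 0 <= e x y by rewrite ler0n.
have t0 q x y : 0 <= t q x y by rewrite ler0n.
have n0 : 0 <= n%:R - (nunits n)%:~R :> R.
  by rewrite subr_ge0 -(mulrz_nat n 1) ler_int nunits_le.
pose A (a b : 'I_n -> 'I_n -> R) (x1 x2 x3 x4 : 'I_n) : R :=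
  a x1 x2 * b x3 x4 + a x1 x3 * b x2 x4 + a x1 x4 * b x2 x3.
pose f (a : 'I_n -> 'I_n -> R) (x y : 'I_n) := h x * h y * a x y.
have AE a b : s4 (fun x1 x2 x3 x4 => h x1 * h x2 * h x3 * h x4 * A a b x1 x2 x3 x4)
   = 3 * (sum2 (f a) * sum2 (f b)).
  transitivity (s4 (fun x1 x2 x3 x4 => f a x1 x2 * f b x3 x4 + f a x1 x3 * f b x2 x4
     + f a x1 x4 * f b x2 x3)).
    by apply: eq_sum4 => x1 x2 x3 x4; rewrite /A /f; ring.
  rewrite !sum4D sum4_12_34 sum4_13_24 sum4_14_23; ring.
have fe : sum2 (f e) = N2.
  by rewrite /f /e sum2_diag; apply: eq_bigr => x _; rewrite expr2.
have ft q : sum2 (f (t q)) = offdiag q by [].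
have P1 (x1 x2 x3 x4 : 'I_n) : (paired x1 x2 x3 x4)%:R <= A e e x1 x2 x3 x4.
  by rewrite /A /e -!natrM -!natrD ler_nat paired_le_sum.
have P2 q (x1 x2 x3 x4 : 'I_n) :
  ((paired (x1 %% q)%N (x2 %% q)%N (x3 %% q)%N (x4 %% q)%N) && ~~ paired x1 x2 x3 x4)%:R
  <= 2 * A (t q) (t q) x1 x2 x3 x4 + A (t q) e x1 x2 x3 x4 + A e (t q) x1 x2 x3 x4.
  rewrite /A /e /t -!natrM -!natrD -!natrM -!natrD ler_nat /paired.
  exact: paired_mod_le.
have key (x1 x2 x3 x4 : 'I_n) : h x1 * h x2 * h x3 * h x4
          * (`|corr4 n x1 x2 x3 x4 - n%:R * (paired x1 x2 x3 x4)%:R|)%:~R <=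
  h x1 * h x2 * h x3 * h x4 * (2 * (n%:R - (nunits n)%:~R) * A e e x1 x2 x3 x4
     + n%:R * (\sum_(q <- primes n)
     (2 * A (t q) (t q) x1 x2 x3 x4 + A (t q) e x1 x2 x3 x4 + A e (t q) x1 x2 x3 x4)) + E).
  rewrite ler_wpM2l ?mulr_ge0 //; apply: le_trans (corr4_error_le _ _ _ _) _.
  rewrite lerD2r lerD // ?ler_wpM2l ?mulr_ge0 //.
  by apply: ler_sum => q _; exact: P2.
apply: (le_trans (ler_sum _ (fun x1 _ => ler_sum _ (fun x2 _ => ler_sum _ (fun x3 _ => ler_sum _ (fun x4 _ => key x1 x2 x3 x4)))))).
rewrite le_eqVlt; apply/orP; left; apply/eqP.
pose HH (x1 x2 x3 x4 : 'I_n) := h x1 * h x2 * h x3 * h x4.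
transitivity (s4 (fun x1 x2 x3 x4 => 2 * (n%:R - (nunits n)%:~R) * (HH x1 x2 x3 x4 * A e e x1 x2 x3 x4)
  + n%:R * \sum_(q <- primes n) (2 * (HH x1 x2 x3 x4 * A (t q) (t q) x1 x2 x3 x4)
    + HH x1 x2 x3 x4 * A (t q) e x1 x2 x3 x4 + HH x1 x2 x3 x4 * A e (t q) x1 x2 x3 x4)
  + E * HH x1 x2 x3 x4)).
  apply: eq_sum4 => x1 x2 x3 x4; rewrite -/(HH x1 x2 x3 x4).
  set S := \sum_(q <- _) _; set S' := \sum_(q <- _) _.
  have -> : S' = HH x1 x2 x3 x4 * S.
    by rewrite /S /S' mulr_sumr; apply: eq_bigr => q _; ring.
  ring.
rewrite !sum4D !sum4Z AE fe sum_pow4.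
have -> : s4 (fun x1 x2 x3 x4 => \sum_(q <- primes n) (2 * (HH x1 x2 x3 x4 * A (t q) (t q) x1 x2 x3 x4)
    + HH x1 x2 x3 x4 * A (t q) e x1 x2 x3 x4 + HH x1 x2 x3 x4 * A e (t q) x1 x2 x3 x4))
  = \sum_(q <- primes n) 6 * offdiag q * (offdiag q + N2).
  transitivity (\sum_(q <- primes n) s4 (fun x1 x2 x3 x4 => (2 * (HH x1 x2 x3 x4 * A (t q) (t q) x1 x2 x3 x4)
    + HH x1 x2 x3 x4 * A (t q) e x1 x2 x3 x4 + HH x1 x2 x3 x4 * A e (t q) x1 x2 x3 x4))).
    rewrite [RHS]exchange_big; apply: eq_bigr => x1 _; rewrite [RHS]exchange_big; apply: eq_bigr => x2 _.
    rewrite [RHS]exchange_big; apply: eq_bigr => x3 _; rewrite [RHS]exchange_big; apply: eq_bigr => x4 _.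
    by [].
  by apply: eq_bigr => q _; rewrite !sum4D sum4Z !AE fe ft; ring.
congr (_ + _ + _); ring.
Qed.

End ErrorBound.

(** * Weights of the degenerate quadruples *)

Section HarmonicBounds.

Variable R : realFieldType.

(** Double counting: every [i] is charged to some related [j], and no [j] is charged more than [c]
    times. *)
Lemma sum_le_rel (I J : finType) (P : pred I) (r : I -> J -> bool)
    (F : I -> R) (G : J -> R) (c : nat) :
  (forall j, 0 <= G j) ->
  (forall i, P i -> exists2 j, r i j & F i <= G j) ->
  (forall j, (\sum_(i | P i) r i j <= c)%N) ->
  \sum_(i | P i) F i <= c%:R * \sum_j G j.
Proof.
move=> G0 H1 H2; apply: (@le_trans _ _ (\sum_(i | P i) \sum_j (r i j)%:R * G j)).
  apply: ler_sum => i /H1[j rij le]; apply: (le_trans le).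
  rewrite (bigD1 j) //= rij mul1r lerDl sumr_ge0 // => k _.
  by rewrite mulr_ge0.
rewrite exchange_big mulr_sumr /=; apply: ler_sum => j _.
by rewrite -mulr_suml ler_wpM2r // -natr_sum ler_nat.
Qed.

Lemma count_eq_le1 n m : (\sum_(y < n) (nat_of_ord y == m) <= 1)%N.
Proof.
case: (ltnP m n) => [mn|nm].
  rewrite (bigD1 (Ordinal mn)) //= eqxx big1 // => y.
  by rewrite -val_eqE /= => /negbTE->.
rewrite big1 // => y _; apply/eqP; rewrite eqb0; apply/eqP => e.
by have := ltn_ord y; lia.
Qed.

Variable n : nat.
Hypothesis n0 : (0 < n)%N.

Definition harmonic : R := \sum_(i < n) (i.+1)%:R^-1.

Lemma harmonic_ge0 : 0 <= harmonic.
Proof. by rewrite sumr_ge0 // => i _; rewrite invr_ge0. Qed.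

Definition dist (x y : nat) : nat := ((x - y) + (y - x))%N.

(** For [x < n], the distance from [2x+1] to the nearest multiple of [2n]; it is odd, hence
    positive. *)
Definition gap (x : nat) : nat := minn (2 * x + 1) (2 * n - (2 * x + 1)).

Lemma sum_inv_gap : \sum_(x < n) (gap x)%:R^-1 <= 2 * harmonic.
Proof.
apply: (@sum_le_rel _ _ _ (fun (x j : 'I_n) => (x == j) || (x == rev_ord j))) => [j|x _|j].
- by rewrite invr_ge0.
- have xn := ltn_ord x; rewrite /gap /minn; case: ltnP => h.
    exists x; rewrite ?eqxx // lef_pV2 ?posrE ?ltr0n ?ler_nat //; lia.
  exists (rev_ord x); first by rewrite rev_ordK eqxx orbT.
  rewrite lef_pV2 ?posrE ?ltr0n ?ler_nat //=; lia.
- apply: (@leq_trans (\sum_(x < n) ((x == j :> nat) + (x == rev_ord j :> nat)))%N).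
    by apply: leq_sum => x _; rewrite -!val_eqE /=; do 2!case: eqP.
  by rewrite big_split; exact: (leq_add (count_eq_le1 n j) (count_eq_le1 n (rev_ord j))).
Qed.

Lemma count_dist_le2 x k : (\sum_(y < n) (dist x y == k) <= 2)%N.
Proof.
apply: (@leq_trans (\sum_(y < n) ((nat_of_ord y == x + k) + (nat_of_ord y == x - k)))%N).
  by apply: leq_sum => y _; rewrite /dist; do 3!case: eqP; lia.
by rewrite big_split; exact: (leq_add (count_eq_le1 n (x + k)%N) (count_eq_le1 n (x - k)%N)).
Qed.

(** Both [d = dist x y] and [n - d] are positive multiples of [q], and each value is taken at most
    twice. Bounding [1/min] by the sum of both reciprocals gives two sums of at most [2 H / q]. *)
Lemma sum_progression_le q (x : 'I_n) : (0 < q)%N -> (q %| n)%N ->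
  \sum_(y < n | (x != y) && (x == y %[mod q]))
     ((minn (dist x y) (n - dist x y))%:R : R)^-1 <= 4 * harmonic / q%:R.
Proof.
move=> q0 qn.
have qd (y : 'I_n) : (x != y) && (x == y %[mod q]) ->
    [/\ 0 < dist x y, dist x y < n, q %| dist x y & q %| n - dist x y]%N.
  move=> /andP[xy m]; have xn := ltn_ord x; have yn := ltn_ord y.
  have d : (q %| dist x y)%N.
    rewrite /dist; case: (leqP x y) => l.
      by rewrite (eqP (_ : x - y == 0)%N) ?subn_eq0 // add0n -eqn_mod_dvd // eq_sym.
    by rewrite (eqP (_ : y - x == 0)%N) ?subn_eq0 ?(ltnW l) // addn0 -eqn_mod_dvd // ltnW.
  move: xy; rewrite -val_eqE /= => xy.
  have d1 : (dist x y < n)%N by rewrite /dist; lia.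
  by split=> //; [rewrite /dist; lia|rewrite dvdn_subr // ltnW].
have half (g : nat -> nat) : (forall y : 'I_n, (x != y) && (x == y %[mod q]) ->
      [/\ 0 < g (dist x y), g (dist x y) <= n & q %| g (dist x y)]%N) ->
    (forall k, \sum_(y < n) (g (dist x y) == k) <= 2)%N ->
    \sum_(y < n | (x != y) && (x == y %[mod q])) (g (dist x y))%:R^-1
      <= 2 * (harmonic / q%:R) :> R.
  move=> Hg Hc; rewrite /harmonic mulr_suml.
  apply: (@sum_le_rel _ _ _ (fun (y j : 'I_n) => g (dist x y) == q * j.+1)%N) => [j|y Py|j].
  - by rewrite mulr_ge0 // invr_ge0.
  - have [g0 gn /dvdnP[k gk]] := Hg y Py.
    have k0 : (0 < k)%N by move: g0; rewrite gk; case: k {gk}.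
    have kn : (k.-1 < n)%N by rewrite prednK // -(leq_pmul2r q0) -gk (leq_trans gn) // leq_pmulr.
    exists (Ordinal kn) => /=; first by rewrite prednK // mulnC gk.
    by rewrite prednK // gk natrM invfM.
  - apply: leq_trans (Hc (q * j.+1)%N); rewrite big_mkcond /=.
    by apply: leq_sum => y _; case: ifP.
apply: (@le_trans _ _ (\sum_(y < n | (x != y) && (x == y %[mod q]))
    ((dist x y)%:R^-1 + (n - dist x y)%:R^-1))).
  apply: ler_sum => y _; rewrite /minn; case: ifP => _.
    by rewrite lerDl invr_ge0.
  by rewrite lerDr invr_ge0.
rewrite big_split /=.
have -> : 4 * harmonic / q%:R = 2 * (harmonic / q%:R) + 2 * (harmonic / q%:R) by ring.
apply: lerD.
  apply: (half id) => [y /qd[]|k]; first by move=> ? /ltnW.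
  exact: count_dist_le2.
apply: (half (fun d => n - d)%N) => [y /qd[d0 dn _ qn']|k].
  by split=> //; lia.
case: (posnP k) => [->|k0].
  have nd (y : 'I_n) : (n - dist x y == 0)%N = false.
    by have := ltn_ord x; have := ltn_ord y; rewrite /dist; lia.
  by rewrite big1 // => y _; rewrite nd.
apply: leq_trans (count_dist_le2 x (n - k)%N); apply: leq_sum => y _.
by do 2!case: eqP; have := ltn_ord x; have := ltn_ord y; rewrite /dist; lia.
Qed.

Variable h : nat -> R.
Hypotheses (h0 : forall x, 0 <= h x)
  (hgap : forall x, (x < n)%N -> h x <= 3 / (gap x)%:R).

Lemma sum_h_le : \sum_(x < n) h x <= 6 * harmonic.
Proof.
apply: (@le_trans _ _ (\sum_(x < n) 3 / (gap x)%:R)).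
  by apply: ler_sum => x _; exact: hgap.
rewrite -mulr_sumr; have -> : 6 * harmonic = 3 * (2 * harmonic) by ring.
by rewrite ler_pM2l // sum_inv_gap.
Qed.

(* From [1/(ab) = (1/a + 1/b)/(a + b)] and the triangle inequality for the
   cyclic distance. *)
Lemma hh_le (x y : 'I_n) : x != y ->
  h x * h y <= 9 / 2 * ((gap x)%:R^-1 + (gap y)%:R^-1)
                 * (minn (dist x y) (n - dist x y))%:R^-1.
Proof.
move=> xy; have xn := ltn_ord x; have yn := ltn_ord y.
apply: (@le_trans _ _ ((3 / (gap x)%:R) * (3 / (gap y)%:R))).
  by rewrite ler_pM ?h0 ?hgap.
set a := gap x; set b := gap y; set m := minn _ _.
have a0 : (0 < a)%N by rewrite /a /gap; lia.
have b0 : (0 < b)%N by rewrite /b /gap; lia.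
move: xy; rewrite -val_eqE /= => xy.
have m0 : (0 < m)%N by rewrite /m /dist; lia.
have mab : (2 * m <= a + b)%N by rewrite /m /a /b /gap /dist; lia.
have A : 0 < a%:R :> R by rewrite ltr0n.
have B : 0 < b%:R :> R by rewrite ltr0n.
have M : 0 < m%:R :> R by rewrite ltr0n.
have : 2 * m%:R <= a%:R + b%:R :> R by rewrite -natrM -natrD ler_nat.
move: (a%:R : R) (b%:R : R) (m%:R : R) A B M => {xy m0 mab a0 b0}a' b' m' A B M le.
have -> : 3 / a' * (3 / b') = 9 / (a' * b') by field; rewrite !gt_eqF.
have -> : 9 / 2 * (a'^-1 + b'^-1) / m' = (9 / (a' * b')) * ((a' + b') / (2 * m')).
  by field; rewrite !gt_eqF.
rewrite ler_peMr ?divr_ge0 ?mulr_ge0 ?(ltW A) ?(ltW B) //.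
by rewrite ler_pdivlMr ?mulr_gt0 // mul1r.
Qed.

(** By symmetry the two terms of [hh_le] have the same sum. Summing over [y] along the progression
    and then over [x] gives [(9/2) * 2 * (2H) * (4H/q)]. *)
Lemma offdiag_le q : (0 < q)%N -> (q %| n)%N ->
  offdiag n h q <= 72 * harmonic ^+ 2 / q%:R.
Proof.
move=> q0 qn; rewrite /offdiag /sum2.
pose c (x y : 'I_n) := (x != y) && (x == y %[mod q]).
pose m (x y : 'I_n) : R := (minn (dist x y) (n - dist x y))%:R^-1.
have mC x y : m x y = m y x by rewrite /m /dist addnC.
have cC x y : c x y = c y x by rewrite /c eq_sym [(_ %% _ == _)%N]eq_sym.
have m_ge0 x y : 0 <= m x y by rewrite invr_ge0.
pose S := \sum_(x < n) \sum_(y < n | c x y) (gap x)%:R^-1 * m x y.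
have ES : \sum_(x < n) \sum_(y < n | c x y) (gap y)%:R^-1 * m x y = S.
  rewrite (exchange_big_dep predT) //=; apply: eq_bigr => y _.
  by apply: eq_big => x; [rewrite cC|rewrite mC].
apply: (@le_trans _ _ (9 / 2 * (S + S))).
  rewrite -{2}ES /S -big_split mulr_sumr /=; apply: ler_sum => x _.
  rewrite -big_split mulr_sumr [leRHS]big_mkcond /=; apply: ler_sum => y _.
  rewrite -/(c x y); case: ifP => [cxy|_]; last by rewrite mulr0.
  rewrite mulr1; apply: le_trans (hh_le _) _; first by case/andP: cxy.
  by rewrite -/(m x y) -mulrDl mulrA.
have SS : S <= 2 * harmonic * (4 * harmonic / q%:R).
  rewrite /S; apply: (@le_trans _ _ (\sum_(x < n) (gap x)%:R^-1 * (4 * harmonic / q%:R))).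
    apply: ler_sum => x _; rewrite -mulr_sumr ler_wpM2l ?invr_ge0 //.
    exact: sum_progression_le.
  rewrite -mulr_suml ler_wpM2r ?sum_inv_gap // divr_ge0 ?mulr_ge0 ?harmonic_ge0 //.
have -> : 72 * harmonic ^+ 2 / q%:R = 9 / 2 * (2 * (2 * harmonic * (4 * harmonic / q%:R))).
  by field; rewrite pnatr_eq0; lia.
have -> : S + S = 2 * S by ring.
by apply: ler_wpM2l; [rewrite divr_ge0|rewrite ler_pM2l].
Qed.

End HarmonicBounds.

(** * The merit factor *)

Section JacobiPolynomial.

Local Open Scope complex_scope.

Variables (n : nat) (r : R).
Hypotheses (nodd : odd n) (nsf : squarefree n) (n1 : (1 < n)%N).

Let n0 : (0 < n)%N. Proof. exact: ltnW. Qed.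
Let a : nat -> R := rotation n (char_coef n) r.
Let s : nat := shift n r.

Lemma rotation_char_coef k : (k < n)%N -> a k = (chi n (k + s))%:~R.
Proof.
move=> kn; rewrite /a /rotation.
have -> : Z.to_nat ((Z.of_nat k + Int_part (Rmult (INR n) r)) mod Z.of_nat n)%ZZ
    = ((k + s) %% n)%N.
  have nz : Z.of_nat n <> Z0 by lia.
  have sE : Z.of_nat s = (Int_part (Rmult (INR n) r) mod Z.of_nat n)%ZZ.
    rewrite /s /shift Z2Nat.id //.
    by have := Z.mod_pos_bound (Int_part (Rmult (INR n) r)) (Z.of_nat n); lia.
  rewrite -Z.add_mod_idemp_r // -sE.
  have e := divn_eq (k + s) n; have l : ((k + s) %% n < n)%N by rewrite ltn_mod.
  rewrite -(Z.mod_unique_pos _ (Z.of_nat n) (Z.of_nat ((k + s) %/ n))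
              (Z.of_nat ((k + s) %% n))) ?Nat2Z.id //; first by lia.
  by move: e l; move: ((k + s) %/ n)%N ((k + s) %% n)%N => q m; nia.
have kn' : ((k + s) %% n < n)%N by rewrite ltn_mod.
rewrite -[chi n (k + s)]chi_mod // /char_coef.
move: ((k + s) %% n)%N kn' => j jn.
case: (posnP j) => [->|j0] /=.
  (* [char_coef] is 0 at [j = 0] by definition; [chi n 0] agrees because [n > 1]. *)
  have : chi n 0 ^+ 2 = 0.
    by rewrite chi_sqr // /coprime gcdn0 (gtn_eqF n1).
  by move/eqP; rewrite sqrf_eq0 => /eqP ->.
have -> : (j <= n - 1)%N by lia.
exact: jacobiE.
Qed.

Lemma sum_rotation_sqr : rsum n (fun k => pow (a k) 2) = (nunits n)%:~R.
Proof.
rewrite rsumE -(sum_chi_sqr_shift n1 s) rmorph_sum; apply: eq_bigr => k _.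
by rewrite RpowE rotation_char_coef ?ltn_ord // rmorphXn.
Qed.

Local Notation z := (zeta n).
Local Notation v := (amp n z s).

(** The contribution of the odd [2n]-th roots divided by [n^2]: after this division the even ones
    contribute [nunits n]. *)
Definition dual_energy : R := (\sum_(j < 2 * n) pow (power n a (Rdiv (Rmult PI (INR j)) (INR n))) 2 / n%:R ^+ 2
  - (nunits n)%:~R)%R.

Let nn0 : (n%:R : R) != 0. Proof. by rewrite pnatr_eq0 -lt0n. Qed.

Lemma dual_energyE : dual_energy%:C = \sum_(j < n) `|\sum_(x < n) (chi n (j + x))%:~R * v x| ^+ 4.
Proof.
have H := sum_values_pow4 n0 (zeta_n n0) (zeta_prim n0) nodd nsf n1 s.
have E : (\sum_(j < 2 * n) pow (power n a (Rdiv (Rmult PI (INR j)) (INR n))) 2)%:C =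
  \sum_(t < 2 * n) `|\sum_(k < n) (chi n (k + s))%:~R * z ^+ (k * t)| ^+ 4.
  rewrite rmorph_sum; apply: eq_bigr => t _.
  rewrite (exprM _ 2 2) RpowE rmorphXn /= -(power_zeta n0); congr (`|_| ^+ 2 ^+ 2).
  by apply: eq_bigr => k _; rewrite rotation_char_coef ?ltn_ord // rmorph_int.
have nC : (n%:R : R[i]) != 0 by rewrite pnatr_eq0 -lt0n.
apply: (mulfI (_ : (n%:R : R[i]) ^+ 2 != 0)); first by rewrite expf_neq0.
apply: (addrI ((n%:R) ^+ 2 * (nunits n)%:~R)); rewrite -H -E /dual_energy.
rewrite rmorphB /= rmorph_int -mulr_suml rmorphM /= fmorphV rmorphXn /= rmorph_nat.
by field.
Qed.

Lemma Lnorm4_dual_energy :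
  pow (Lnorm 4 n a) 4 = n%:R * ((nunits n)%:~R + dual_energy) / 2.
Proof.
rewrite (Lnorm4_pow4 _ n0) /dual_energy -mulr_suml; set S := \sum_(j < _) _.
rewrite RdivE RmultE INRE; have -> : IZR 2 = 2 by [].
by field.
Qed.

Lemma sum_amp_norm2 : \sum_(x < n) `|v x| ^+ 2 = 1.
Proof.
have nC : (n%:R : R[i]) != 0 by rewrite pnatr_eq0 -lt0n.
transitivity ((n%:R ^+ 2)^-1 * \sum_(x < n) `|kern n z x| ^+ 2).
  rewrite mulr_sumr; apply: eq_bigr => x _.
  rewrite /amp !normrM !normrX (root_norm1 n0 (zeta_n n0)) !expr1n mul1r normfV normr_nat.
  by rewrite exprMn exprVn mulrC.
by rewrite (sum_kern_norm2 n0 (zeta_n n0) (zeta_prim n0)) mulVf // expf_neq0.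
Qed.

Lemma sum_amp_norm4 : \sum_(x < n) `|v x| ^+ 4 = (3^-1 + 2 / (3 * n%:R ^+ 2)).
Proof.
have nC : (n%:R : R[i]) != 0 by rewrite pnatr_eq0 -lt0n.
transitivity ((n%:R ^+ 4)^-1 * \sum_(x < n) `|kern n z x| ^+ 4).
  rewrite mulr_sumr; apply: eq_bigr => x _.
  rewrite /amp !normrM !normrX (root_norm1 n0 (zeta_n n0)) !expr1n mul1r normfV normr_nat.
  by rewrite exprMn exprVn mulrC.
by rewrite (sum_kern_norm4 n0 (zeta_n n0) (zeta_prim n0)); field.
Qed.

Lemma sum_amp_sqr (w : nat) : (w < n)%N -> (n %| w + 2 * s)%N ->
  `|\sum_(x < n) v x ^+ 2| ^+ 2 = ((2 * w%:R + 2 - n%:R) / n%:R) ^+ 2.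
Proof.
move=> wn dw; have nC : (n%:R : R[i]) != 0 by rewrite pnatr_eq0 -lt0n.
have -> : \sum_(x < n) v x ^+ 2
   = (n%:R ^+ 2)^-1 * \sum_(x < n) (z ^+ 2) ^+ (2 * s * x) * kern n z x ^+ 2.
  rewrite mulr_sumr; apply: eq_bigr => x _.
  have -> : (z ^+ 2) ^+ (2 * s * x) = ((z ^+ 2) ^+ (x * s)) ^+ 2.
    by rewrite -[RHS]exprM; congr (_ ^+ _); lia.
  by rewrite /amp; field.
rewrite (sum_twisted_kern_sqr n0 (zeta_n n0) (zeta_prim n0) wn dw).
rewrite !normrM normfV !normrX normr_nat (root_norm1 n0 (zeta_n n0)) expr1n mulr1.
rewrite !exprMn real_normK; last first.
  by apply: rpredB; [apply: rpredD; [apply: rpredM|]|]; apply: realn.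
by field.
Qed.

(** The norm on [R[i]] takes values in [R[i]], whereas [error_bound] needs weights in a real
    field. *)
Definition habs (x : nat) : R := complex.Re `|v x|.

Lemma habsE x : (habs x)%:C = `|v x|.
Proof. by rewrite /habs RRe_real // normr_real. Qed.

Lemma habs_ge0 x : 0 <= habs x.
Proof. by rewrite -ler0c habsE. Qed.

(** By [kernM], the modulus of the weight is [2 / (n |z^(2x+1) - 1|)], that is [1 / (n sin t)]. *)
Lemma habs_gap x : (x < n)%N -> habs x <= 3 / (gap n x)%:R.
Proof.
move=> xn.
have := congr1 (fun t => `|t|) (kernM (zeta_n n0) x).
rewrite normrM norm_zeta_sub1 // normrN normr_nat.
set sn := Rmult 2 _ => hk.
have := minn_sin_le xn; rewrite -/(gap n x); set t := sin _.
rewrite !INRE => /RleP le.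
have snE : sn = 2 * t by [].
have g0 : 0 < (gap n x)%:R :> R by rewrite ltr0n /gap; lia.
have hE : habs x * (n%:R * t) = 1.
  apply: (@complexI R); rewrite rmorphM /= habsE rmorphM /= rmorph_nat /amp.
  rewrite !normrM !normrX (root_norm1 n0 (zeta_n n0)) !expr1n mul1r normfV normr_nat.
  have nC : (n%:R : R[i]) != 0 by rewrite pnatr_eq0 -lt0n.
  move: hk; rewrite snE rmorphM /= rmorph_nat => hk.
  apply: (mulfI (_ : (2 : R[i]) != 0)); first by rewrite pnatr_eq0.
  by rewrite mulr1 -[RHS]hk; field.
have le' : (gap n x)%:R <= 3 * (n%:R * t).
  by move: le; rewrite !RmultE mulrA.
rewrite ler_pdivlMr //; apply: (@le_trans _ _ (habs x * (3 * (n%:R * t)))).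
  by rewrite ler_wpM2l // habs_ge0.
by rewrite mulrCA hE mulr1.
Qed.

Lemma sum_habs2 : \sum_(x < n) habs x ^+ 2 = 1.
Proof.
apply: (@complexI R); rewrite rmorph_sum /= -[RHS]sum_amp_norm2.
by apply: eq_bigr => x _; rewrite rmorphXn /= habsE.
Qed.

Hypothesis big : forall p, p \in primes n -> (250000 <= p)%N.

Local Notation H := (harmonic R n).
Local Notation P := ((pdiv n)%:R : R).

(** The bound on [offdiag q] decreases with [q], so every prime is charged like the smallest one,
    whence the factor [size (primes n)]. *)
Lemma Q_estimate (w : nat) (E : R) : (w < n)%N -> (n %| w + 2 * s)%N ->
  0 <= E -> n%:R ^+ 7 <= E ^+ 8 ->
  `|dual_energy - n%:R * (((2 * w%:R + 2 - n%:R) / n%:R) ^+ 2 + 4 / 3 - 4 / (3 * n%:R ^+ 2))|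
  <= 6 * (n%:R - (nunits n)%:~R)
     + n%:R * ((size (primes n))%:R * (6 * (72 * H ^+ 2 / P) * (72 * H ^+ 2 / P + 1)))
     + E * (6 * H) ^+ 4.
Proof.
move=> wn dw E0 E8.
pose M' : R := (((2 * w%:R + 2 - n%:R) / n%:R) ^+ 2 + 4 / 3 - 4 / (3 * n%:R ^+ 2))%R.
rewrite -/M'; have := sum_pow4_corr_main n v; rewrite -dual_energyE sum_amp_norm2 sum_amp_norm4 (sum_amp_sqr wn dw).
set M := (X in n%:R * X).
have -> : M = M'%:C.
  rewrite /M /M' !(rmorphD, rmorphN, rmorphM, rmorphXn, fmorphV, rmorph_nat) /=.
  have nC : (n%:R : R[i]) != 0 by rewrite pnatr_eq0 -lt0n.
  by field.
have -> : dual_energy%:C - n%:R * M'%:C = ((dual_energy - n%:R * M')%R)%:C.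
  by rewrite !(rmorphD, rmorphN, rmorphM, rmorph_nat) /=.
set S := sum4 _.
pose S' := sum4 (fun x1 x2 x3 x4 : 'I_n => habs x1 * habs x2 * habs x3 * habs x4
  * (`|corr4 n x1 x2 x3 x4 - n%:R * (paired x1 x2 x3 x4)%:R|)%:~R).
have -> : S = S'%:C.
  rewrite /S /S' /sum4 rmorph_sum; apply: eq_bigr => x1 _.
  rewrite rmorph_sum; apply: eq_bigr => x2 _; rewrite rmorph_sum; apply: eq_bigr => x3 _.
  rewrite rmorph_sum; apply: eq_bigr => x4 _.
  by rewrite !rmorphM /= !habsE rmorph_int.
have -> : `|((dual_energy - n%:R * M')%R)%:C| = (`|dual_energy - n%:R * M'|%R)%:C.
  by rewrite normc_def /= expr0n addr0 sqrtr_sqr.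
rewrite lecR => le1; apply: (le_trans le1).
apply: le_trans (error_bound nodd nsf n1 big habs_ge0 E0 E8) _.
rewrite sum_habs2 expr1n mulr1.
have H0 : 0 <= H by exact: harmonic_ge0.
have P0 : 0 < P by rewrite ltr0n pdiv_gt0.
set D := 72 * H ^+ 2 / P.
have D0 : 0 <= D by rewrite /D divr_ge0 ?mulr_ge0 ?exprn_ge0 // ltW.
apply: lerD; last first.
  have S0 : 0 <= \sum_(x < n) habs x by rewrite sumr_ge0 // => i _; exact: habs_ge0.
  have S6 : \sum_(x < n) habs x <= 6 * H by exact: sum_h_le habs_gap.
  by rewrite ler_wpM2l // lerXn2r // nnegrE mulr_ge0.
rewrite lerD2l ler_wpM2l //.
have -> : (size (primes n))%:R * (6 * D * (D + 1)) = \sum_(q <- primes n) 6 * D * (D + 1).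
  by elim: (primes n) => [|q l IH]; rewrite ?big_nil ?mul0r // big_cons -IH /= -addn1 natrD; ring.
rewrite big_seq [leRHS]big_seq; apply: ler_sum => q qn.
have [pq dq] : prime q /\ (q %| n)%N by move: qn; rewrite mem_primes => /and3P[].
have T0 : 0 <= offdiag n habs q.
  by rewrite /offdiag /sum2 sumr_ge0 // => x _; rewrite sumr_ge0 // => y _; rewrite !mulr_ge0 ?habs_ge0.
have TD : offdiag n habs q <= D.
  apply: le_trans (offdiag_le n0 habs_ge0 habs_gap (prime_gt0 pq) dq) _.
  rewrite /D ler_wpM2l ?mulr_ge0 ?exprn_ge0 // lef_pV2 ?posrE ?ltr0n ?pdiv_gt0 ?(prime_gt0 pq) //.
  by rewrite ler_nat pdiv_min_dvd // prime_gt1.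
apply: ler_pM; [exact: mulr_ge0|exact: addr_ge0| |by rewrite lerD2r].
by rewrite ler_pM2l.
Qed.

End JacobiPolynomial.

Local Open Scope R_scope.

(** From [2^omega <= n], with [omega] the number of prime factors, and [ln 2 > 1/2]. *)
Lemma size_primes_le (n : nat) : (0 < n)%N -> INR (size (primes n)) <= 2 * ln (INR n).
Proof.
move=> n0; have N0 : 0 < INR n by apply: lt_0_INR; lia.
have le : (2 ^ size (primes n) <= n)%N.
  rewrite {2}(prod_prime_decomp n0) prime_decompE big_map /=.
  have : all (fun p => (2 <= p ^ logn p n)%N) (primes n).
    apply/allP => p pn; have := pn; rewrite mem_primes => /and3P[pp _ _].
    apply: (leq_trans (prime_gt1 pp)); rewrite -{1}(expn1 p) leq_exp2l ?prime_gt1 //.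
    by rewrite logn_gt0.
  elim: (primes n) => [|p l IH] /=; first by rewrite big_nil.
  by case/andP=> hp /IH h; rewrite big_cons expnS leq_mul.
have : INR (2 ^ size (primes n)) <= INR n by apply: le_INR; lia.
have -> : INR (2 ^ size (primes n)) = 2 ^ size (primes n).
  by rewrite INRE RpowE natrX.
move=> le2; have : ln (2 ^ size (primes n)) <= ln (INR n).
  by apply: ln_le => //; apply: pow_lt; Lra.lra.
rewrite ln_pow; last Lra.lra.
have := ln_lt_2; have := pos_INR (size (primes n)) => p0 l2 h.
have : INR (size (primes n)) * / 2 <= INR (size (primes n)) * ln 2.
  by apply: Rmult_le_compat_l => //; Lra.lra.
Lra.lra.
Qed.

Lemma merit_factor_close (n : nat) (r : R) :
  odd n -> squarefree n -> (1 < n)%N -> (250000 <= pdiv n)%N ->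
  2 <= ln (INR n) ->
  let L := ln (INR n) in let kap := L ^ 3 / INR (pdiv n) in
  let del := 7016 * kap + tail_const / L in
  kap <= / 1000 -> 2 * del <= / 12 ->
  Rabs (merit_factor n (rotation n (char_coef n) r) - f_lim r) <= 144 * del.
Proof.
move=> nodd nsf n1 bigP L2 L kap del hk hd.
have n0 : (0 < n)%N by exact: ltnW.
have N0 : 0 < INR n by apply: lt_0_INR; lia.
have LN : L + 1 <= INR n.
  by have := exp_ineq1_le L; rewrite /L exp_ln //; Lra.lra.
have n3 : (3 <= n)%N.
  by apply/ssrnat.leP; apply: INR_le; rewrite /=; rewrite /L in LN; Lra.lra.
set s := shift n r.
have sn : (s < n)%N.
  rewrite /s /shift.
  by have := Z.mod_pos_bound (Int_part (INR n * r)) (Z.of_nat n); lia.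
(* The residue of [-2s]; adding [2n] keeps the natural subtraction exact since [s < n]. *)
pose w := ((2 * n - 2 * s) %% n)%N.
have wn : (w < n)%N by rewrite ltn_mod.
have dw : (n %| w + 2 * s)%N.
  by rewrite /dvdn /w modnDml subnK ?modnMl // leq_mul2l ltnW.
have big p : p \in primes n -> (250000 <= p)%N.
  rewrite mem_primes => /and3P[pp _ pn]; apply: (leq_trans bigP).
  by rewrite pdiv_min_dvd // prime_gt1.
have E0 : (0 <= INR n * exp (- (L / 8)))%R.
  by apply/RleP; apply: Rmult_le_pos; [Lra.lra|exact: Rlt_le (exp_pos _)].
have E8 : (n%:R ^+ 7 <= (INR n * exp (- (L / 8))) ^+ 8)%R.
  rewrite -!RpowE -RmultE exp_ln_pow8 // INRE; exact: lexx.
have hQ := Q_estimate nodd nsf n1 big wn dw E0 E8.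
rewrite /merit_factor Lnorm2_pow4 // sum_rotation_sqr // Lnorm4_dual_energy // f_limE.
pose Phi : R := ((nunits n)%:~R)%R.
have y1 : (4 * Rabs (reduced r) - 1) ^ 2 <= 1.
  have [lo hi] := reduced_bounds r.
  have : Rabs (reduced r) <= / 2 by apply: Rabs_le; Lra.lra.
  have := Rabs_pos (reduced r) => a0 a1.
  rewrite -(pow1 2); apply: pow_maj_Rabs; apply: Rabs_le; Lra.lra.
have PP : 0 < INR (pdiv n) by apply: lt_0_INR; have := pdiv_gt0 n; lia.
have H0 : 0 <= harmonic R n by apply/RleP; exact: harmonic_ge0.
have H1 : harmonic R n <= 1 + L.
  have -> : harmonic R n = (\sum_(i < n) (INR i.+1)^-1)%R.
    by apply: eq_bigr => i _; rewrite INRE.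
  exact: harmonic_le_ln.
have F0 : 0 <= INR n - Phi.
  apply/RleP; rewrite RminusE INRE subr_ge0 /Phi -(mulrz_nat n 1) ler_int.
  exact: nunits_le.
have F1 : (INR n - Phi) * INR (pdiv n) <= INR n * INR (size (primes n)).
  apply/RleP; rewrite !RmultE RminusE !INRE.
  have minP p : p \in primes n -> (pdiv n <= p)%N.
    by rewrite mem_primes => /and3P[pp _ pn]; rewrite pdiv_min_dvd // prime_gt1.
  have := nonunits_le nodd nsf n1 (pdiv_gt0 n) minP.
  by rewrite -(ler_int R) intrM intrB !mulrz_nat natrM.
have hQ' : Rabs (dual_energy n r - INR n * (((2 * INR w + 2 - INR n) / INR n) ^ 2
      + 4 / 3 - 4 / (3 * INR n ^ 2)))
    <= 6 * (INR n - Phi) + INR n * (INR (size (primes n)) *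
      (6 * (72 * harmonic R n ^ 2 / INR (pdiv n)) * (72 * harmonic R n ^ 2 / INR (pdiv n) + 1)))
       + INR n * exp (- (L / 8)) * (6 * harmonic R n) ^ 4.
  move: hQ; set e := exp _ => hQ; apply/RleP.
  rewrite !(RabsE, RplusE, RminusE, RmultE, RdivE, RpowE, RinvE, IZRposE, INRE).
  by rewrite INRE in hQ.
have om0 := pos_INR (size (primes n)); have om1 := size_primes_le n0.
have ph := phase_limit n3 wn dw.
have N3 : 3 <= INR n by rewrite /L in LN; Lra.lra.
have L1 : 1 <= L by rewrite /L; Lra.lra.
have LN' : L <= INR n by Lra.lra.
have := @merit_estimate (INR n) L (INR (pdiv n)) (INR (size (primes n))) Phi
  (dual_energy n r) (harmonic R n) ((2 * INR w + 2 - INR n) / INR n) (4 * Rabs (reduced r) - 1)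
  N3 L1 LN' PP (conj om0 om1) F0 F1 (conj H0 H1) hQ' ph y1 hk hd.
by rewrite INRE.
Qed.

Theorem theorem2 (S : nat -> Prop) (r : R) :
  (* S is infinite *)
  (forall N : nat, exists n : nat, (N <= n)%N /\ S n) ->
  (* S consists of odd square-free integers > 1 *)
  (forall n : nat, S n -> odd n /\ squarefree n /\ (1 < n)%N) ->
  (* (log n)^3 / p_n -> 0 as n -> oo in S *)
  (forall eps : R, 0 < eps -> exists N : nat, forall n : nat, S n -> (N <= n)%N ->
      Rabs (ln (INR n) ^ 3 / INR (smallest_prime_factor n)) < eps) ->
  (* lim_{n -> oo, n in S} F(J_r) = f(r) *)
  forall eps : R, 0 < eps -> exists N : nat, forall n : nat, S n -> (N <= n)%N ->
    Rabs (merit_factor n (rotation n (char_coef n) r) - f_lim r) < eps.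
Proof.
move=> _ HS Hlog eps eps0.
have [k [B [k0 k1 HkB]]] := choose_parameters eps0.
have [N1 HN1] := Hlog k k0; have [N2 HN2] := ln_unbounded (Rmax B 2).
exists (maxn N1 N2) => n Sn; rewrite geq_max => /andP[n1 n2].
have [nodd [nsf ngt1]] := HS n Sn.
have hk := HN1 n Sn n1; have hL := HN2 n n2.
rewrite /smallest_prime_factor in hk.
set L := ln (INR n) in hk hL; set P := INR (pdiv n) in hk.
have LB : B <= L by exact: Rle_trans (Rmax_l _ _) hL.
have L2 : 2 <= L by exact: Rle_trans (Rmax_r _ _) hL.
have P0 : 0 < P by apply: lt_0_INR; have := pdiv_gt0 n; lia.
have hk' : L ^ 3 / P < k by exact: Rle_lt_trans (Rle_abs _) hk.
(* As [L^3 >= 1], the inequality [L^3 / P < k <= 1/250000] already bounds [1 / P]. *)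
have bigP : (250000 <= pdiv n)%N.
  have L3 : 1 <= L ^ 3 by apply: pow_R1_Rle; Lra.lra.
  have iP : 0 < / P by exact: Rinv_0_lt_compat.
  have h1 : / P < / 250000.
    have : 1 * / P <= L ^ 3 * / P by apply: Rmult_le_compat_r; Lra.lra.
    by rewrite /Rdiv in hk'; Lra.lra.
  have h2 : 250000 < P by apply: Rinv_lt_cancel => //; Lra.lra.
  apply/ssrnat.leP; apply: INR_le; rewrite -/P.
  have -> : INR 250000 = 250000 by rewrite INR_IZR_INZ; congr IZR; lia.
  exact: Rlt_le.
have [d1 d2] := HkB (L ^ 3 / P) L (Rlt_le _ _ hk') ltac:(Lra.lra) LB.
apply: Rle_lt_trans (merit_factor_close r nodd nsf ngt1 bigP L2 _ d1) d2.
by apply: Rle_trans (Rlt_le _ _ hk') _; Lra.lra.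
Qed.
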